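(* Let $\mathcal{M}$ be a Type $\mathcal{B}$ surface which is not of Type $\mathcal{A}$ and with $\rho_{s,\nabla}\neq0$. Let $\mu\notin\{0,-1\}$. Then $\dim\{E(\mu,\nabla)\}\geq1$ if and only if $\mathcal{M}$ is linearly equivalent to a surface with, for some $\varepsilon\in\{+1,-1\}$, $$C_{12}{}^1=0,\quad C_{22}{}^1=\varepsilon,\quad C_{22}{}^2=2\varepsilon C_{11}{}^2,\quad C_{11}{}^1-C_{12}{}^2-1\neq0,$$ $$\mu=\frac{-(C_{11}{}^1)^2+2C_{11}{}^1C_{12}{}^2+2\varepsilon(C_{11}{}^2)^2-(C_{12}{}^2)^2+2C_{12}{}^2+1}{(C_{11}{}^1-C_{12}{}^2-1)^2}.$$ Furthermore, $\dim\{E(\mu,\nabla)\}=2$ if and only if $\mathcal{M}$ is linearly equivalent to one of the following, for some $\varepsilon\in\{+1,-1\}$: \begin{enumerate} \item $C_{11}{}^1=-1+C_{12}{}^2$, $C_{11}{}^2=0$, $C_{12}{}^1=0$, $C_{22}{}^1=\varepsilon$, $C_{22}{}^2=0$, $\mu=\frac12C_{12}{}^2\neq0$. \item $C_{11}{}^1=-\frac12(5+16\varepsilon(C_{11}{}^2)^2)$, $C_{12}{}^1=0$, $C_{12}{}^2=-\frac12(3+8\varepsilon(C_{11}{}^2)^2)$, $C_{22}{}^1=\varepsilon$, $C_{22}{}^2=2\varepsilon C_{11}{}^2$, $\mu=-\frac{3+8\varepsilon(C_{11}{}^2)^2}{4+8\varepsilon(C_{11}{}^2)^2}$, $C_{11}{}^2\notin\{0,\pm\frac{1}{\sqrt2}\}$.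 \end{enumerate}
   Context: A Type $\mathcal{B}$ surface is $M=\mathbb{R}^+\times\mathbb{R}$ with coordinates $(x^1,x^2)$, $x^1>0$, and a torsion free connection $\nabla$, $\nabla_{\partial_{x^i}}\partial_{x^j}=\Gamma_{ij}{}^k\partial_{x^k}$, with Christoffel symbols $\Gamma_{ij}{}^k=(x^1)^{-1}C_{ij}{}^k$ where $C_{ij}{}^k=C_{ji}{}^k\in\mathbb{R}$ are constants, and which is not flat. It is also of Type $\mathcal{A}$ if it admits a coordinate atlas in which all Christoffel symbols are constant; it is known that this happens if and only if $(C_{12}{}^1,C_{22}{}^1,C_{22}{}^2)=(0,0,0)$. Two Type $\mathcal{B}$ surfaces are linearly equivalent if they are intertwined by some map $(x^1,x^2)\mapsto(x^1,ax^1+bx^2)$ with $a,b\in\mathbb{R}$, $b\neq0$. With $R_\nabla(x,y)=\nabla_x\nabla_y-\nabla_y\nabla_x-\nabla_{[x,y]}$, the Ricci tensor is $\rho_\nabla(x,y)=\operatorname{Tr}\{z\mapsto R_\nabla(z,x)y\}$ and its symmetrization is $\rho_{s,\nabla}(x,y)=\frac12\{\rho_\nabla(x,y)+\rho_\nabla(y,x)\}$. The Hessian is $\mathcal{H}_\nabla f=(\partial_{x^i}\partial_{x^j}f-\Gamma_{ij}{}^k\partial_{x^k}f)\,dx^i\otimes dx^j$. For $\mu\in\mathbb{R}$, $E(\mu,\nabla)=\{f\in C^\infty(M):\mathcal{H}_\nabla f=\mu f\rho_{s,\nabla}\}$, a real vector space.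
   Formalization: In item (2) the values C_11^2 = ±1/√2 are excluded only for ε = −1, where μ is undefined; for ε = +1 they are allowed, since there dim E(μ,∇) = 2 (with μ = −7/8) though the surface is equivalent to neither printed item. *)

(* Defs.v *)
From Stdlib Require Import Reals.
From Coquelicot Require Import Coquelicot.
Open Scope R_scope.

(** * Affine connections on open subsets of the plane *)

Inductive coord : Set := x1 | x2.

Definition sum2 (F : coord -> R) : R := F x1 + F x2.

Definition comp (i : coord) (p : R * R) : R :=
  match i with x1 => fst p | x2 => snd p end.

Definition dd (i : coord) (f : R * R -> R) (p : R * R) : R :=
  match i with
  | x1 => Derive (fun t => f (t, snd p)) (fst p)
  | x2 => Derive (fun t => f (fst p, t)) (snd p)
  end.

(** Functions and connections are total on [R * R]; only their values on the
    open set [U] under consideration matter.  [ex_diff_n] requires all iterated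
    partial derivatives up to order [n] to exist and be continuous at the
    point. *)
Definition smooth_on (U : R * R -> Prop) (f : R * R -> R) : Prop :=
  forall n p, U p -> ex_diff_n (fun a b => f (a, b)) n (fst p) (snd p).

(** [Gam i j k] is the Christoffel symbol with lower indices [i], [j] and
    upper index [k]. *)
Definition connection : Type := coord -> coord -> coord -> R * R -> R.

(** Coefficient of the [l]-th coordinate field in R(d_i, d_j) d_k, where
    R(x, y) = nabla_x nabla_y - nabla_y nabla_x - nabla_[x,y]. *)
Definition curvature (Gam : connection) (i j k l : coord) (p : R * R) : R :=
  dd i (Gam j k l) p - dd j (Gam i k l) p
  + sum2 (fun n => Gam j k n p * Gam i n l p - Gam i k n p * Gam j n l p).

(** rho(x, y) = Tr (z |-> R(z, x) y). *)
Definition ricci (Gam : connection) (j k : coord) (p : R * R) : R :=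
  sum2 (fun i => curvature Gam i j k i p).

Definition ricci_sym (Gam : connection) (j k : coord) (p : R * R) : R :=
  / 2 * (ricci Gam j k p + ricci Gam k j p).

Definition hessian (Gam : connection) (f : R * R -> R) (i j : coord)
    (p : R * R) : R :=
  dd i (dd j f) p - sum2 (fun k => Gam i j k p * dd k f p).

Definition flat_on (U : R * R -> Prop) (Gam : connection) : Prop :=
  forall i j k l p, U p -> curvature Gam i j k l p = 0.

(** [phi] carries [Gam] on [U] to [Gam']: both sides are the [c]-th component
    of phi_* (nabla_{d_i} d_j) = nabla'_{phi_* d_i} (phi_* d_j). *)
Definition intertwines (U : R * R -> Prop) (phi : R * R -> R * R)
    (Gam Gam' : connection) : Prop :=
  forall i j c p, U p ->
    sum2 (fun k => Gam i j k p * dd k (fun q => comp c (phi q)) p)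
    = dd i (dd j (fun q => comp c (phi q))) p
      + sum2 (fun a => sum2 (fun b =>
          Gam' a b c (phi p)
          * dd i (fun q => comp a (phi q)) p
          * dd j (fun q => comp b (phi q)) p)).

Definition diffeo (U V : R * R -> Prop) (phi psi : R * R -> R * R) : Prop :=
  (forall i, smooth_on U (fun q => comp i (phi q))) /\
  (forall i, smooth_on V (fun q => comp i (psi q))) /\
  (forall p, U p -> V (phi p) /\ psi (phi p) = p) /\
  (forall q, V q -> U (psi q) /\ phi (psi q) = q).

(** * Type B surfaces *)

Definition half_plane (p : R * R) : Prop := 0 < fst p.

Definition typeB_conn (C : coord -> coord -> coord -> R) : connection :=
  fun i j k p => / fst p * C i j k.

Record typeB : Type := TypeB {
  coef :> coord -> coord -> coord -> R;
  coef_sym : forall i j k, coef i j k = coef j i k;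
  not_flat : ~ flat_on half_plane (typeB_conn coef)
}.

Definition nabla (M : typeB) : connection := typeB_conn (coef M).

(** The half plane is covered by domains [U] of coordinate charts [phi] in
    which all Christoffel symbols are constant. *)
Definition is_typeA (M : typeB) : Prop :=
  forall p, half_plane p ->
  exists (U V : R * R -> Prop) (phi psi : R * R -> R * R)
         (G : coord -> coord -> coord -> R),
    open U /\ open V /\ U p /\ (forall q, U q -> half_plane q) /\
    diffeo U V phi psi /\
    intertwines U phi (nabla M) (fun i j k _ => G i j k).

Definition linearly_equivalent (M N : typeB) : Prop :=
  exists a b : R, b <> 0 /\
    intertwines half_plane (fun p => (fst p, a * fst p + b * snd p))
      (nabla M) (nabla N).

Definition ricci_sym_zero (M : typeB) : Prop :=
  forall i j p, half_plane p -> ricci_sym (nabla M) i j p = 0.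

(** Membership of the restriction of [f] to the half plane in E(mu, nabla). *)
Definition E (mu : R) (M : typeB) (f : R * R -> R) : Prop :=
  smooth_on half_plane f /\
  forall i j p, half_plane p ->
    hessian (nabla M) f i j p = mu * f p * ricci_sym (nabla M) i j p.

(** * Dimension of a space of real functions on the half plane *)

Fixpoint lincomb (n : nat) (c : nat -> R) (b : nat -> R * R -> R)
    (p : R * R) : R :=
  match n with
  | O => 0
  | S m => lincomb m c b p + c m * b m p
  end.

Definition independent (n : nat) (b : nat -> R * R -> R) : Prop :=
  forall c, (forall p, half_plane p -> lincomb n c b p = 0) ->
    forall i, (i < n)%nat -> c i = 0.

Definition dim_ge (W : (R * R -> R) -> Prop) (n : nat) : Prop :=
  exists b, (forall i, (i < n)%nat -> W (b i)) /\ independent n b.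

Definition has_dim (W : (R * R -> R) -> Prop) (n : nat) : Prop :=
  exists b, (forall i, (i < n)%nat -> W (b i)) /\ independent n b /\
    forall f, W f ->
      exists c, forall p, half_plane p -> f p = lincomb n c b p.

(* Main.v *)
(** For [f] in [E mu M] put [u = (f, x1 d_1 f, x1 d_2 f)].  The equation becomes
    a system [x1 d_i u = A_i u] with constant 3x3 matrices, and symmetry of the
    derivatives forces [[A_2, A_1] u = A_2 u].  Hence the [A_i] act on the span
    [W] of all values [u], where [A_2] is nilpotent; if [W <> 0] it therefore
    contains a vector killed by [A_2], and one of the form [(1, al, 0)] unless
    the surface is of Type A.  This says that [x1 ^ al] is a solution, and the
      three
    algebraic equations for [al] exclude [C_22^1 = 0] and, after the shear that
    achieves [C_12^1 = 0] and [C_22^1 = eps], give the first normal form.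
    When the dimension is 2, the commutator supplies a linear relation
    [tau (x1 d_1 f - al f) = b x1 d_2 f]; differentiating it gives
    [b (2 tau + 1) = 0] and [al = C_12^2], which are the two cases, and
    conversely [x1 ^ al] and [x1 ^ al (x2 - 2 b x1)] are then a basis. *)

From Stdlib Require Import Reals Lra Lia Classical.
From Coquelicot Require Import Coquelicot.
Require Import Defs.
Open Scope R_scope.

(** * Smoothness of elementary functions of two variables *)

Definition slice (i : coord) (p : R * R) (s : R) : R * R :=
  match i with x1 => (s, snd p) | x2 => (fst p, s) end.

Lemma slice_comp i p : slice i p (comp i p) = p.
Proof. destruct i, p; reflexivity. Qed.

Lemma dd_slice i f p : dd i f p = Derive (fun s => f (slice i p s)) (comp i p).
Proof. destruct i; reflexivity. Qed.

Lemma locally_slice (P : R * R -> Prop) i p :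
  locally p P -> locally (comp i p) (fun s => P (slice i p s)).
Proof.
  intros [eps H]; exists eps; intros s Hs.
  apply H; destruct i, p; split; simpl in *; auto; apply ball_center.
Qed.

Lemma locally_locally_2d (P : R * R -> Prop) p :
  locally p P -> locally_2d (fun u v => P (u, v)) (fst p) (snd p).
Proof.
  intros H; apply locally_2d_locally; destruct p as [u v]; simpl.
  revert H; apply filter_imp; intros [s t]; auto.
Qed.

Lemma dd_ext_loc i f g p :
  locally p (fun q => f q = g q) -> dd i f p = dd i g p.
Proof.
  intros H; rewrite !dd_slice; apply Derive_ext_loc.
  exact (locally_slice _ i p H).
Qed.

Lemma open_half_plane : open half_plane.
Proof.
  apply (open_comp (fun p : R * R => fst p) (fun s => 0 < s)).
  - intros p _; apply continuous_fst.
  - apply open_gt.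
Qed.

(** The charts and solutions below are elementary expressions in the coordinates. Reifying them
    reduces smoothness and iterated partial derivatives to structural inductions based on the
    syntactic derivative [D]. *)
Inductive term : Type :=
| Var (i : coord) | Cst (r : R) | Add (t u : term) | Mul (t u : term)
| Exp (t : term) | LnX | InvX.

Fixpoint eval (t : term) (p : R * R) : R :=
  match t with
  | Var i => comp i p
  | Cst r => r
  | Add t u => eval t p + eval u p
  | Mul t u => eval t p * eval u p
  | Exp t => exp (eval t p)
  | LnX => ln (fst p)
  | InvX => / fst p
  end.

Fixpoint defined (t : term) (p : R * R) : Prop :=
  match t with
  | Var _ | Cst _ => True
  | Add t u | Mul t u => defined t p /\ defined u p
  | Exp t => defined t p
  | LnX | InvX => half_plane p
  end.

Definition dvar (i j : coord) : R :=
  match i, j with x1, x1 | x2, x2 => 1 | _, _ => 0 end.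

Fixpoint D (i : coord) (t : term) : term :=
  match t with
  | Var j => Cst (dvar i j)
  | Cst _ => Cst 0
  | Add t u => Add (D i t) (D i u)
  | Mul t u => Add (Mul (D i t) u) (Mul t (D i u))
  | Exp t => Mul (D i t) (Exp t)
  | LnX => Mul (Cst (dvar i x1)) InvX
  | InvX => Mul (Cst (- dvar i x1)) (Mul InvX InvX)
  end.

Lemma defined_locally t p : defined t p -> locally p (defined t).
Proof.
  induction t; simpl; intros H.
  1,2: now apply filter_forall.
  1,2: destruct H; apply filter_and; auto.
  - auto.
  - now apply open_half_plane.
  - now apply open_half_plane.
Qed.

Lemma defined_D i t p : defined t p -> defined (D i t) p.
Proof. induction t; simpl; intuition. Qed.

Lemma is_derive_eval i t p : defined t p ->
  is_derive (fun s => eval t (slice i p s)) (comp i p) (eval (D i t) p).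
Proof.
  induction t as [j|r|t IHt u IHu|t IHt u IHu|t IHt| |]; simpl; intros H.
  - destruct i, j; simpl; auto_derive; auto.
  - auto_derive; auto.
  - destruct H; apply (is_derive_plus (K := R_AbsRing) (V := R_NormedModule));
      auto.
  - destruct H as [Ht Hu]; specialize (IHt Ht); specialize (IHu Hu).
    generalize (is_derive_mult _ _ _ _ _ IHt IHu Rmult_comm).
    rewrite slice_comp; auto.
  - generalize (is_derive_comp exp _ _ _ _ (is_derive_exp _) (IHt H)).
    rewrite slice_comp; auto.
  - unfold half_plane in H; destruct i; simpl; auto_derive; auto; ring.
  - unfold half_plane in H; destruct i; simpl; auto_derive; auto;
      try (apply Rgt_not_eq; auto); field; lra.
Qed.

Lemma dd_eval i t p : defined t p -> dd i (eval t) p = eval (D i t) p.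
Proof.
  intros H; rewrite dd_slice; apply is_derive_unique, is_derive_eval, H.
Qed.

Lemma dd_dd_eval i j t p :
  defined t p -> dd i (dd j (eval t)) p = eval (D i (D j t)) p.
Proof.
  intros H; rewrite <- (dd_eval i (D j t)) by now apply defined_D.
  apply dd_ext_loc.
  generalize (defined_locally _ _ H); apply filter_imp; intros q Hq.
  now apply dd_eval.
Qed.

Lemma continuity_eval t p : defined t p ->
  continuity_2d_pt (fun u v => eval t (u, v)) (fst p) (snd p).
Proof.
  induction t as [j|r|t IHt u IHu|t IHt u IHu|t IHt| |]; simpl; intros H.
  - destruct j; [apply continuity_2d_pt_id1 | apply continuity_2d_pt_id2].
  - apply continuity_2d_pt_const.
  - destruct H; apply continuity_2d_pt_plus; auto.
  - destruct H; apply continuity_2d_pt_mult; auto.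
  - apply (continuity_1d_2d_pt_comp exp); auto.
    apply derivable_continuous_pt, derivable_pt_exp.
  - apply (continuity_1d_2d_pt_comp ln); [|apply continuity_2d_pt_id1].
    apply derivable_continuous_pt, ex_derive_Reals_0.
    unfold half_plane in H; auto_derive; auto.
  - apply continuity_2d_pt_inv; [apply continuity_2d_pt_id1|].
    apply Rgt_not_eq, H.
Qed.

(** The partial derivatives of a term are again terms, so the induction on the order keeps the term
    general. They agree with [D] near the point because [defined] is an open condition. *)
Lemma ex_diff_n_eval n : forall t p, defined t p ->
  ex_diff_n (fun u v => eval t (u, v)) n (fst p) (snd p).
Proof.
  induction n as [|n IH]; intros t p H; simpl.
  - split; auto; now apply continuity_eval.
  - split; [now apply continuity_eval|].
    split; [eexists; apply (is_derive_eval x1 t p H)|].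
    split; [eexists; apply (is_derive_eval x2 t p H)|].
    split.
    + apply ex_diff_n_ext_loc with (fun u v => eval (D x1 t) (u, v)).
      * generalize (locally_locally_2d _ _ (defined_locally _ _ H)).
        apply locally_2d_impl, locally_2d_forall; intros u v Huv; symmetry.
        apply (dd_eval x1 t (u, v) Huv).
      * now apply IH, defined_D.
    + apply ex_diff_n_ext_loc with (fun u v => eval (D x2 t) (u, v)).
      * generalize (locally_locally_2d _ _ (defined_locally _ _ H)).
        apply locally_2d_impl, locally_2d_forall; intros u v Huv; symmetry.
        apply (dd_eval x2 t (u, v) Huv).
      * now apply IH, defined_D.
Qed.

Lemma smooth_eval (U : R * R -> Prop) t :
  (forall p, U p -> defined t p) -> smooth_on U (eval t).
Proof. intros H n p Up; apply ex_diff_n_eval, H, Up. Qed.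

(** * The equation as a linear system with constant coefficients *)

(** [curv0] and [rho0] are the curvature and the symmetrized Ricci tensor with the factor [/ x1 ^ 2]
    stripped. The [dvar] terms come from differentiating [/ x1]. *)
Definition curv0 (C : coord -> coord -> coord -> R) (i j k l : coord) : R :=
  - dvar i x1 * C j k l + dvar j x1 * C i k l
  + sum2 (fun n => C j k n * C i n l - C i k n * C j n l).

Definition rho0 (C : coord -> coord -> coord -> R) (j k : coord) : R :=
  / 2 * (sum2 (fun i => curv0 C i j k i) + sum2 (fun i => curv0 C i k j i)).

Lemma dd_typeB_conn C i j k l p : half_plane p ->
  dd i (typeB_conn C j k l) p = - dvar i x1 * C j k l / fst p ^ 2.
Proof.
  intros H.
  transitivity (dd i (eval (Mul InvX (Cst (C j k l)))) p); [reflexivity|].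
  rewrite dd_eval by (simpl; auto).
  simpl; field; apply Rgt_not_eq, H.
Qed.

Lemma curvature_typeB C i j k l p : half_plane p ->
  curvature (typeB_conn C) i j k l p = / fst p ^ 2 * curv0 C i j k l.
Proof.
  intros H; unfold curvature; rewrite !dd_typeB_conn by assumption.
  unfold typeB_conn, curv0, sum2; field; apply Rgt_not_eq, H.
Qed.

Lemma ricci_sym_typeB C j k p : half_plane p ->
  ricci_sym (typeB_conn C) j k p = / fst p ^ 2 * rho0 C j k.
Proof.
  intros H; unfold ricci_sym, ricci, rho0, sum2.
  rewrite !curvature_typeB by assumption; ring.
Qed.

Lemma not_flat_of_rho0 C i j : rho0 C i j <> 0 ->
  ~ flat_on half_plane (typeB_conn C).
Proof.
  intros H F; apply H.
  assert (Z : forall i j k l, curv0 C i j k l = 0).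
  { intros i' j' k l; specialize (F i' j' k l (1, 0) Rlt_0_1).
    rewrite curvature_typeB in F by (apply Rlt_0_1); simpl in F.
    rewrite <- F; field. }
  unfold rho0, sum2; rewrite !Z; ring.
Qed.

Record vec : Type := Vec { v0 : R; v1 : R; v2 : R }.

Definition vcomp (i : coord) (v : vec) : R :=
  match i with x1 => v1 v | x2 => v2 v end.

Definition vadd u v := Vec (v0 u + v0 v) (v1 u + v1 v) (v2 u + v2 v).
Definition vscal r v := Vec (r * v0 v) (r * v1 v) (r * v2 v).
Definition vzero := Vec 0 0 0.

Lemma vec_eq u v : v0 u = v0 v -> v1 u = v1 v -> v2 u = v2 v -> u = v.
Proof. destruct u, v; simpl; intros; subst; reflexivity. Qed.

Definition linear_map (T : vec -> vec) : Prop :=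
  (forall u v, T (vadd u v) = vadd (T u) (T v)) /\
  (forall r v, T (vscal r v) = vscal r (T v)).

(** Linearity is stated as expansion in the standard basis, so that a form can be differentiated
    coefficient by coefficient. *)
Definition linear_form (phi : vec -> R) : Prop :=
  forall v, phi v = v0 v * phi (Vec 1 0 0) + v1 v * phi (Vec 0 1 0)
                    + v2 v * phi (Vec 0 0 1).

Definition xd (i : coord) (f : R * R -> R) (p : R * R) : R := fst p * dd i f p.

Definition jet (f : R * R -> R) (p : R * R) : vec :=
  Vec (f p) (xd x1 f p) (xd x2 f p).

(** The equation [E mu M] is the closed system
    [x1 * d_i (jet f) = trans M mu i (jet f)]. *)
Definition trans (C : coord -> coord -> coord -> R) (mu : R) (i : coord)
    (v : vec) : vec :=
  let row j := dvar i x1 * vcomp j v + sum2 (fun k => C i j k * vcomp k v)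
               + mu * rho0 C i j * v0 v in
  Vec (vcomp i v) (row x1) (row x2).

Lemma linear_map_trans C mu i : linear_map (trans C mu i).
Proof.
  split; intros; destruct i; apply vec_eq; unfold trans, sum2; simpl; ring.
Qed.

Lemma smooth_dd i f : smooth_on half_plane f -> smooth_on half_plane (dd i f).
Proof.
  intros H n p Hp; destruct (H (S n) p Hp) as (_ & _ & _ & H1 & H2).
  destruct i; assumption.
Qed.

Lemma smooth_is_derive i f p : smooth_on half_plane f -> half_plane p ->
  is_derive (fun s => f (slice i p s)) (comp i p) (dd i f p).
Proof.
  intros H Hp; destruct (H 1%nat p Hp) as (_ & H1 & H2 & _).
  rewrite dd_slice; apply Derive_correct; destruct i; assumption.
Qed.

Lemma smooth_continuity f p : smooth_on half_plane f -> half_plane p ->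
  continuity_2d_pt (fun u v => f (u, v)) (fst p) (snd p).
Proof. intros H Hp; apply (H 0%nat p Hp). Qed.

Lemma dd_comm f p : smooth_on half_plane f -> half_plane p ->
  dd x1 (dd x2 f) p = dd x2 (dd x1 f) p.
Proof.
  intros H Hp; destruct p as [u v].
  apply (Schwarz (fun u v => f (u, v)) u v).
  - generalize (locally_locally_2d _ _ (open_half_plane _ Hp)).
    apply locally_2d_impl, locally_2d_forall; intros s t Hst.
    split; [eexists; exact (smooth_is_derive x1 f (s, t) H Hst)|].
    split; [eexists; exact (smooth_is_derive x2 f (s, t) H Hst)|].
    split; eexists.
    + exact (smooth_is_derive x1 (dd x2 f) (s, t) (smooth_dd x2 f H) Hst).
    + exact (smooth_is_derive x2 (dd x1 f) (s, t) (smooth_dd x1 f H) Hst).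
  - exact (smooth_continuity (dd x1 (dd x2 f)) (u, v)
             (smooth_dd _ _ (smooth_dd _ _ H)) Hp).
  - exact (smooth_continuity (dd x2 (dd x1 f)) (u, v)
             (smooth_dd _ _ (smooth_dd _ _ H)) Hp).
Qed.

Lemma is_derive_jet mu M f i p : E mu M f -> half_plane p ->
  is_derive (fun s => v0 (jet f (slice i p s))) (comp i p)
    (/ fst p * v0 (trans M mu i (jet f p))) /\
  forall j, is_derive (fun s => vcomp j (jet f (slice i p s))) (comp i p)
    (/ fst p * vcomp j (trans M mu i (jet f p))).
Proof.
  intros [Sf Hf] Hp; assert (Hx : fst p <> 0) by apply Rgt_not_eq, Hp.
  split.
  - generalize (smooth_is_derive i f p Sf Hp); simpl.
    replace (/ fst p * vcomp i (jet f p)) with (dd i f p); auto.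
    destruct i; unfold jet, xd; simpl; field; auto.
  - intros j.
    apply (is_derive_ext (fun s => fst (slice i p s) * dd j f (slice i p s))).
    { intros s; destruct j; reflexivity. }
    (* Product rule for [x1 * d_j f]: the first summand is the [dvar] term of [trans]; in the second
       the equation replaces the second derivative. *)
    replace (/ fst p * vcomp j (trans M mu i (jet f p)))
      with (dvar i x1 * dd j f (slice i p (comp i p))
            + fst (slice i p (comp i p)) * dd i (dd j f) p).
    + apply (is_derive_mult (fun s => fst (slice i p s))
               (fun s => dd j f (slice i p s))).
      * exact (is_derive_eval i (Var x1) p I).
      * exact (smooth_is_derive i _ p (smooth_dd j f Sf) Hp).
      * apply Rmult_comm.
    + rewrite slice_comp.
      specialize (Hf i j p Hp); unfold hessian, nabla in Hf.
      rewrite ricci_sym_typeB in Hf by assumption.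
      unfold typeB_conn in Hf.
      replace (dd i (dd j f) p) with
        (mu * f p * (/ fst p ^ 2 * rho0 M i j)
         + sum2 (fun k => / fst p * M i j k * dd k f p)) by (rewrite <- Hf; ring).
      destruct i, j; unfold trans, jet, xd, sum2; simpl; field; auto.
Qed.

Lemma is_derive_form phi mu M f i p :
  linear_form phi -> E mu M f -> half_plane p ->
  is_derive (fun s => phi (jet f (slice i p s))) (comp i p)
    (/ fst p * phi (trans M mu i (jet f p))).
Proof.
  intros Hphi Ef Hp.
  destruct (is_derive_jet mu M f i p Ef Hp) as [H0 H].
  generalize (H x1) (H x2); clear H; simpl; intros H1 H2.
  eapply is_derive_ext; [intros s; symmetry; apply Hphi|].
  rewrite (Hphi (trans M mu i (jet f p))).
  replace (/ fst p * _) with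
   (phi (Vec 1 0 0) * (/ fst p * v0 (trans M mu i (jet f p)))
   + phi (Vec 0 1 0) * (/ fst p * v1 (trans M mu i (jet f p)))
   + phi (Vec 0 0 1) * (/ fst p * v2 (trans M mu i (jet f p)))) by ring.
  apply (is_derive_plus (K := R_AbsRing) (V := R_NormedModule)).
  1: apply (is_derive_plus (K := R_AbsRing) (V := R_NormedModule)).
  all: eapply is_derive_ext;
    [intros s; apply Rmult_comm | now apply is_derive_scal].
Qed.

(** * Linear relations among the jets of solutions *)

Definition vanishing mu M (phi : vec -> R) : Prop :=
  linear_form phi /\ forall f p, E mu M f -> half_plane p -> phi (jet f p) = 0.

Lemma linear_form_comp phi T :
  linear_form phi -> linear_map T -> linear_form (fun v => phi (T v)).
Proof.
  intros Hphi [Hadd Hscal] v.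
  replace v with (vadd (vscal (v0 v) (Vec 1 0 0))
    (vadd (vscal (v1 v) (Vec 0 1 0)) (vscal (v2 v) (Vec 0 0 1)))) at 1.
  - rewrite !Hadd, !Hscal.
    rewrite (Hphi (vadd _ _)), (Hphi (T (Vec 1 0 0))), (Hphi (T (Vec 0 1 0))),
      (Hphi (T (Vec 0 0 1))); simpl; ring.
  - apply vec_eq; simpl; ring.
Qed.

(** A form that is zero along every solution has zero derivative there, and up to the factor [/ x1]
    this derivative is the form composed with [trans]. *)
Lemma vanishing_trans mu M phi i :
  vanishing mu M phi -> vanishing mu M (fun v => phi (trans M mu i v)).
Proof.
  intros [Hlin H]; split.
  - apply linear_form_comp; [assumption | apply linear_map_trans].
  - intros f p Ef Hp.
    assert (D1 := is_derive_form phi mu M f i p Hlin Ef Hp).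
    apply is_derive_unique in D1.
    rewrite (Derive_ext_loc _ (fun _ => 0)), Derive_const in D1.
    + apply Rmult_eq_reg_l with (/ fst p); [now rewrite <- D1, Rmult_0_r|].
      apply Rinv_neq_0_compat, Rgt_not_eq, Hp.
    + generalize (locally_slice _ i p (open_half_plane _ Hp)).
      apply filter_imp; intros s Hs; now apply H.
Qed.

(** The integrability defect of the system: with [A_i] the map [trans C mu i], this is
    [A_2 A_1 - A_1 A_2 - A_2]. The last term arises from differentiating the factor [/ x1]. *)
Definition bracket_defect C mu (v : vec) : vec :=
  vadd (trans C mu x2 (trans C mu x1 v))
    (vscal (-1) (vadd (trans C mu x1 (trans C mu x2 v)) (trans C mu x2 v))).

Lemma linear_form_v0 : linear_form v0.
Proof. intros v; simpl; ring. Qed.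

Lemma linear_form_vcomp i : linear_form (vcomp i).
Proof. intros v; destruct i; simpl; ring. Qed.

Lemma linear_map_bracket_defect C mu : linear_map (bracket_defect C mu).
Proof.
  destruct (linear_map_trans C mu x1) as [A1 S1].
  destruct (linear_map_trans C mu x2) as [A2 S2].
  split; intros; unfold bracket_defect;
    rewrite ?A1, ?A2, ?S1, ?S2, ?A1, ?A2, ?S1, ?S2;
    apply vec_eq; simpl; ring.
Qed.

(** Symmetry of second derivatives, applied to [dd j f]. *)
Lemma bracket_defect_jet mu M f p :
  E mu M f -> half_plane p -> bracket_defect M mu (jet f p) = vzero.
Proof.
  intros Ef Hp; assert (Hx : fst p <> 0) by apply Rgt_not_eq, Hp.
  assert (sym : forall k, M x2 x1 k = M x1 x2 k) by (intros; apply coef_sym).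
  assert (rsym : rho0 M x2 x1 = rho0 M x1 x2)
    by (unfold rho0; ring).
  (* On the jet of a solution, [h k j] is [x1 ^ 2] times the second derivative [d_k d_j f]. *)
  set (h k j v := sum2 (fun l => M k j l * vcomp l v) + mu * rho0 M k j * v0 v).
  assert (hlin : forall k j, linear_form (h k j)).
  { intros k j v; unfold h, sum2; simpl; ring. }
  assert (H2 : forall k j q, half_plane q ->
            dd k (dd j f) q = / fst q ^ 2 * h k j (jet f q)).
  { intros k j q Hq; assert (Hy : fst q <> 0) by apply Rgt_not_eq, Hq.
    generalize (proj2 Ef k j q Hq); unfold hessian, nabla.
    rewrite ricci_sym_typeB by assumption; intros Hh.
    apply Rminus_diag_uniq; apply Rminus_diag_eq in Hh.
    rewrite <- Hh; unfold h, sum2, jet, xd, typeB_conn; simpl; field; auto. }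
  assert (H3 : forall i k j, dd i (dd k (dd j f)) p =
    - 2 * dvar i x1 * / fst p ^ 3 * h k j (jet f p)
    + / fst p ^ 3 * h k j (trans M mu i (jet f p))).
  { intros i k j.
    rewrite (dd_ext_loc i _ (fun q => / fst q ^ 2 * h k j (jet f q))).
    2:{ generalize (open_half_plane _ Hp); apply filter_imp; intros; auto. }
    rewrite dd_slice; apply is_derive_unique.
    replace (_ + _) with
      ((- 2 * dvar i x1 * / fst p ^ 3) * h k j (jet f (slice i p (comp i p)))
      + / fst (slice i p (comp i p)) ^ 2
        * (/ fst p * h k j (trans M mu i (jet f p))))
      by (rewrite slice_comp; field; auto).
    apply (is_derive_mult (fun s => / fst (slice i p s) ^ 2)
             (fun s => h k j (jet f (slice i p s)))).
    - destruct i; simpl; auto_derive; auto; try (simpl; field; auto).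
    - exact (is_derive_form _ mu M f i p (hlin k j) Ef Hp).
    - apply Rmult_comm. }
  (* Equality of the two mixed derivatives of [d_j f], with [/ x1 ^ 3] cancelled. *)
  assert (H4 : forall j,
    - 2 * h x2 j (jet f p) + h x2 j (trans M mu x1 (jet f p))
    = h x1 j (trans M mu x2 (jet f p))).
  { intros j.
    assert (Hc := dd_comm (dd j f) p (smooth_dd j f (proj1 Ef)) Hp).
    rewrite !H3 in Hc; simpl dvar in Hc.
    apply Rmult_eq_reg_l with (/ fst p ^ 3);
      [| now apply Rinv_neq_0_compat, pow_nonzero].
    rewrite Rmult_plus_distr_l; lra. }
  generalize (H4 x1) (H4 x2); unfold h.
  generalize (jet f p); clear - sym rsym; intros [a b c].
  unfold trans, sum2; simpl; rewrite !sym, !rsym; intros E1 E2.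
  (* The first component vanishes by symmetry of the coefficients; the other two are [E1] and
     [E2]. *)
  apply vec_eq; unfold bracket_defect, trans, sum2; simpl;
    rewrite !sym, !rsym; lra.
Qed.

(** The double annihilator, hence the span, of all jet values, obtained without choosing a basis. *)
Definition jet_space mu M (v : vec) : Prop :=
  forall phi, vanishing mu M phi -> phi v = 0.

Lemma jet_space_jet mu M f p :
  E mu M f -> half_plane p -> jet_space mu M (jet f p).
Proof. intros Ef Hp phi [_ H]; now apply H. Qed.

Lemma jet_space_trans mu M i v :
  jet_space mu M v -> jet_space mu M (trans M mu i v).
Proof.
  intros Hv phi Hphi; exact (Hv _ (vanishing_trans mu M phi i Hphi)).
Qed.

Lemma jet_space_bracket mu M v : jet_space mu M v ->
  bracket_defect M mu v = vzero.
Proof.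
  intros Hv.
  assert (H : forall phi, linear_form phi -> phi vzero = 0 ->
            phi (bracket_defect M mu v) = 0).
  { intros phi Hphi Hz; apply (Hv (fun v => phi (bracket_defect M mu v))).
    split.
    - apply linear_form_comp; [assumption | apply linear_map_bracket_defect].
    - intros f p Ef Hp; now rewrite bracket_defect_jet. }
  apply vec_eq; [apply (H v0) | apply (H v1) | apply (H v2)]; try reflexivity;
    intros u; simpl; ring.
Qed.

(** * Nilpotency and the power solution *)

Lemma vec_inj u v : u = v -> v0 u = v0 v /\ v1 u = v1 v /\ v2 u = v2 v.
Proof. intros ->; auto. Qed.

(** With [chi] the characteristic polynomial of [T], the hypothesis
    [T S = S T + T] turns [chi T = 0] into [T (chi' T) = 0], and iterating
    this derivation isolates the cube of [T]. *)
Lemma bracket_nilpotent (W : vec -> Prop) S T t s d :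
  linear_map S -> linear_map T ->
  (forall v, W v -> W (S v)) -> (forall v, W v -> W (T v)) ->
  (forall v, W v -> T (S v) = vadd (S (T v)) (T v)) ->
  (forall v, T (T (T v)) =
     vadd (vscal t (T (T v))) (vadd (vscal s (T v)) (vscal d v))) ->
  forall v, W v -> T (T (T v)) = vzero.
Proof.
  intros [Sadd Sscal] [Tadd Tscal] WS WT br CH.
  assert (br2 : forall v, W v -> T (T (S v)) =
            vadd (S (T (T v))) (vscal 2 (T (T v)))).
  { intros v Wv; rewrite br, Tadd, br by auto; apply vec_eq; simpl; ring. }
  assert (br3 : forall v, W v -> T (T (T (S v))) =
            vadd (S (T (T (T v)))) (vscal 3 (T (T (T v))))).
  { intros v Wv; rewrite br2, Tadd, Tscal, br by auto.
    apply vec_eq; simpl; ring. }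
  intros v Wv.
  assert (F1 : forall v, W v -> vscal 3 (T (T (T v))) =
     vadd (vscal (2 * t) (T (T v))) (vscal s (T v))).
  { intros u Wu; generalize (CH (S u)) (f_equal S (CH u)).
    rewrite br3, br2, br by assumption.
    rewrite !Sadd, !Sscal; intros H1 H2.
    destruct (vec_inj _ _ H1) as (P0 & P1 & P2);
      destruct (vec_inj _ _ H2) as (Q0 & Q1 & Q2).
    apply vec_eq; simpl in *; lra. }
  (* Evaluating a relation at [S u] and subtracting [S] of the relation at [u] multiplies the
     coefficient of each power of [T] by its exponent. *)
  assert (next : forall x y,
    (forall v, W v -> vscal x (T (T (T v))) =
       vadd (vscal y (T (T v))) (vscal s (T v))) ->
    forall v, W v -> vscal (3 * x) (T (T (T v))) =
       vadd (vscal (2 * y) (T (T v))) (vscal s (T v))).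
  { intros x y H u Wu; generalize (H (S u) (WS u Wu)) (f_equal S (H u Wu)).
    rewrite br3, br2, br by assumption.
    rewrite !Sadd, !Sscal; intros H1 H2.
    destruct (vec_inj _ _ H1) as (P0 & P1 & P2);
      destruct (vec_inj _ _ H2) as (Q0 & Q1 & Q2).
    apply vec_eq; simpl in *; lra. }
  (* The three relations have coefficients [3 ^ k], [2 ^ k * t], [s] for k = 1, 2, 3. Eliminating
     the lower powers of [T] leaves a nonzero multiple of its cube, by a Vandermonde determinant. *)
  assert (F2 := next _ _ F1); assert (F3 := next _ _ F2).
  specialize (F1 v Wv); specialize (F2 v Wv); specialize (F3 v Wv).
  destruct (vec_inj _ _ F1) as (P0 & P1 & P2);
    destruct (vec_inj _ _ F2) as (Q0 & Q1 & Q2);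
    destruct (vec_inj _ _ F3) as (R0 & R1 & R2).
  apply vec_eq; simpl in *; lra.
Qed.

(** The Cayley-Hamilton identity of the 3x3 matrix of [T], with its characteristic polynomial
    written out. *)
Lemma trans_x2_cube (C : coord -> coord -> coord -> R) mu v :
  (forall k, C x2 x1 k = C x1 x2 k) ->
  let T := trans C mu x2 in
  T (T (T v)) =
  vadd (vscal (C x1 x2 x1 + C x2 x2 x2) (T (T v)))
   (vadd (vscal (C x1 x2 x2 * C x2 x2 x1 + mu * rho0 C x2 x2
                 - C x1 x2 x1 * C x2 x2 x2) (T v))
     (vscal (mu * rho0 C x1 x2 * C x2 x2 x1
             - C x1 x2 x1 * (mu * rho0 C x2 x2)) v)).
Proof.
  intros sym T; unfold T.
  assert (rsym : rho0 C x2 x1 = rho0 C x1 x2) by (unfold rho0; ring).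
  apply vec_eq; unfold trans, sum2; simpl; rewrite !sym, ?rsym; ring.
Qed.

(** Since [T] is nilpotent on the jet space, the last nonzero vector among [w], [T w] and [T (T w)]
    is killed by [T]. *)
Lemma jet_space_kernel mu M w : jet_space mu M w -> w <> vzero ->
  exists v, jet_space mu M v /\ v <> vzero /\ trans M mu x2 v = vzero.
Proof.
  intros Ww w0; set (T := trans M mu x2).
  assert (N : T (T (T w)) = vzero).
  { apply (bracket_nilpotent (jet_space mu M) (trans M mu x1) T
     (M x1 x2 x1 + M x2 x2 x2)
     (M x1 x2 x2 * M x2 x2 x1 + mu * rho0 M x2 x2 - M x1 x2 x1 * M x2 x2 x2)
     (mu * rho0 M x1 x2 * M x2 x2 x1 - M x1 x2 x1 * (mu * rho0 M x2 x2)));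
      [apply linear_map_trans | apply linear_map_trans
      | apply jet_space_trans | apply jet_space_trans | | | assumption].
    - intros v Wv; generalize (jet_space_bracket mu M v Wv).
      unfold bracket_defect, T; intros H;
        destruct (vec_inj _ _ H) as (H0 & H1 & H2).
      apply vec_eq; cbn [vadd vscal vzero v0 v1 v2] in *; lra.
    - intros v; apply trans_x2_cube; intros; apply coef_sym. }
  assert (dec : forall v, v = vzero \/ v <> vzero).
  { intros [a b c]; destruct (Req_dec a 0), (Req_dec b 0), (Req_dec c 0);
      subst; auto; right; intros Hv; injection Hv; auto. }
  destruct (dec (T w)) as [H1|H1]; [exists w; auto|].
  destruct (dec (T (T w))) as [H2|H2].
  - exists (T w); unfold T in *; auto using jet_space_trans.
  - exists (T (T w)); unfold T in *; auto using jet_space_trans.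
Qed.

Lemma rho0_coefs (C : coord -> coord -> coord -> R) :
  (forall k, C x2 x1 k = C x1 x2 k) ->
  rho0 C x1 x1 = C x1 x1 x1 * C x1 x2 x2 - C x1 x1 x2 * C x1 x2 x1
    + C x1 x1 x2 * C x2 x2 x2 + C x1 x2 x2 - C x1 x2 x2 ^ 2 /\
  rho0 C x1 x2 = - C x1 x1 x2 * C x2 x2 x1 - C x1 x2 x1 / 2
    + C x1 x2 x1 * C x1 x2 x2 + C x2 x2 x2 / 2 /\
  rho0 C x2 x1 = rho0 C x1 x2 /\
  rho0 C x2 x2 = C x1 x1 x1 * C x2 x2 x1 + C x1 x2 x1 * C x2 x2 x2
    - C x1 x2 x1 ^ 2 - C x1 x2 x2 * C x2 x2 x1 - C x2 x2 x1.
Proof.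
  intros sym; unfold rho0, curv0, sum2; simpl; rewrite !sym.
  repeat split; field.
Qed.

(** [x1 ^ al] solves the equation for the coefficients [C]. *)
Definition power_solution (C : coord -> coord -> coord -> R) mu al : Prop :=
  al ^ 2 - (C x1 x1 x1 + 1) * al = mu * rho0 C x1 x1 /\
  - C x1 x2 x1 * al = mu * rho0 C x1 x2 /\
  - C x2 x2 x1 * al = mu * rho0 C x2 x2.

Definition rho0_zero C := forall i j, rho0 C i j = 0.

Lemma jet_space_power (M : typeB) mu w :
  ~ (M x1 x2 x1 = 0 /\ M x2 x2 x1 = 0 /\ M x2 x2 x2 = 0) ->
  ~ rho0_zero M -> mu <> 0 -> mu <> -1 ->
  jet_space mu M w -> w <> vzero ->
  M x2 x2 x1 <> 0 /\ exists al, power_solution M mu al.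
Proof.
  intros notA rho_neq mu0 mu1 Ww w0.
  assert (sym : forall k, M x2 x1 k = M x1 x2 k) by (intros; apply coef_sym).
  destruct (rho0_coefs M sym) as (r11 & r12 & r21 & r22).
  (* If the kernel vector has [v0 v = 0], its image under [trans M mu x1] replaces it: the bracket
     relation keeps it in the kernel, and its first component is [v1 v], which is nonzero because
     [v2 v = 0]. *)
  assert (K : exists v, jet_space mu M v /\ v0 v <> 0 /\
              trans M mu x2 v = vzero).
  { destruct (jet_space_kernel mu M w Ww w0) as (v & Wv & nz & Tv).
    destruct (Req_dec (v0 v) 0) as [Z|Z]; [|exists v; auto].
    exists (trans M mu x1 v); repeat split.
    - now apply jet_space_trans.
    - destruct v as [f p q]; simpl in *; subst f.
      destruct (vec_inj _ _ Tv) as (H0 & H1 & H2); intros ->; apply nz;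
        simpl in H0; subst; reflexivity.
    - generalize (jet_space_bracket mu M v Wv); unfold bracket_defect.
      rewrite Tv; destruct (linear_map_trans M mu x1) as [_ Hs].
      replace (trans M mu x1 vzero) with vzero.
      + intros H; destruct (vec_inj _ _ H) as (H0 & H1 & H2); apply vec_eq;
        cbn [vadd vscal vzero v0 v1 v2] in *; lra.
      + apply vec_eq; unfold trans, sum2; simpl; ring. }
  destruct K as (v & Wv & nz & Tv).
  set (al := v1 v / v0 v).
  assert (Wal : jet_space mu M (Vec 1 al 0)).
  { intros phi Hphi; generalize (Wv phi Hphi).
    rewrite (proj1 Hphi (Vec 1 al 0)), (proj1 Hphi v); simpl.
    destruct (vec_inj _ _ Tv) as (H0 & _); simpl in H0; rewrite H0; intros H.
    apply Rmult_eq_reg_l with (v0 v); auto.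
    rewrite Rmult_0_r; etransitivity; [|exact H]; unfold al; field; auto. }
  assert (Tal : trans M mu x2 (Vec 1 al 0) = vzero).
  { destruct (vec_inj _ _ Tv) as (H0 & H1 & H2).
    unfold trans, sum2 in *; simpl in *; apply vec_eq; simpl; [reflexivity | |];
      apply Rmult_eq_reg_l with (v0 v); auto; rewrite (Rmult_0_r (v0 v));
      [etransitivity; [|exact H1] | etransitivity; [|exact H2]]; unfold al;
      rewrite H0;
      field_simplify_eq; auto. }
  clearbody al; clear - sym notA rho_neq mu0 mu1 r11 r12 r21 r22 Wal Tal.
  assert (Br := jet_space_bracket mu M _ Wal).
  unfold bracket_defect in Br; rewrite Tal in Br.
  destruct (vec_inj _ _ Br) as (B0 & B1 & B2);
    destruct (vec_inj _ _ Tal) as (T0 & T1 & T2).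
  unfold trans, sum2 in *; simpl in *.
  rewrite !sym in *; rewrite !r21 in *.
  assert (S2 : - M x1 x2 x1 * al = mu * rho0 M x1 x2) by lra.
  assert (S3 : - M x2 x2 x1 * al = mu * rho0 M x2 x2) by lra.
  (* [trans M mu x1] sends (1, al, 0) to (al, be, 0), which must again lie in the kernel. Hence
     [be = al ^ 2], the first power equation, unless [C_12^1] and [C_22^1] both vanish. *)
  set (be := (M x1 x1 x1 + 1) * al + mu * rho0 M x1 x1).
  assert (Hc : M x1 x2 x1 * (be - al ^ 2) = 0).
  { transitivity (M x1 x2 x1 * be + mu * rho0 M x1 x2 * al);
      [rewrite <- S2; ring | unfold be].
    rewrite <- B1, <- S2; ring. }
  assert (He : M x2 x2 x1 * (be - al ^ 2) = 0).
  { transitivity (M x2 x2 x1 * be + mu * rho0 M x2 x2 * al);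
      [rewrite <- S3; ring | unfold be].
    rewrite <- B2, <- S2; ring. }
  (* If [C_22^1 = 0], then [C_12^1 = 0] leads to the Type A coefficients. Otherwise
     [C_22^2 = C_12^1] and [al = - mu * C_12^2], so [mu * (mu + 1) * (C_12^2) ^ 2 = 0], and the
     symmetric Ricci tensor would vanish. *)
  assert (e0 : M x2 x2 x1 <> 0).
  { intros e0; rewrite e0 in *.
    assert (Z22 : rho0 M x2 x2 = 0) by (apply Rmult_eq_reg_l with mu; lra).
    destruct (Req_dec (M x1 x2 x1) 0) as [c0|c0].
    - apply notA; rewrite c0 in *; repeat split.
      apply Rmult_eq_reg_l with mu; [rewrite r12 in S2; lra | assumption].
    - apply Rmult_integral in Hc; destruct Hc as [Hc|Hc]; [contradiction|].
      assert (g : M x2 x2 x2 = M x1 x2 x1).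
      { apply Rmult_eq_reg_l with (M x1 x2 x1); auto; lra. }
      rewrite g in *; clear g.
      assert (al = - (mu * M x1 x2 x2)).
      { apply Rmult_eq_reg_l with (M x1 x2 x1); auto.
        rewrite r12 in S2; lra. }
      subst al.
      assert (d0 : M x1 x2 x2 = 0).
      { assert (Hd : mu * (mu + 1) * (M x1 x2 x2 * M x1 x2 x2) = 0).
        { unfold be in Hc; rewrite r11 in Hc; lra. }
        apply Rmult_integral in Hd; destruct Hd as [Hd|Hd].
        - apply Rmult_integral in Hd; lra.
        - now apply Rmult_integral in Hd; destruct Hd. }
      rewrite d0 in *; apply rho_neq.
      intros [] []; rewrite ?r21; lra. }
  split; [assumption|]; exists al.
  repeat split; auto.
  apply Rmult_integral in He; destruct He as [He|He]; [contradiction|].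
  unfold be in He; simpl in *; lra.
Qed.

(** * Linear equivalence and Type A charts *)

Definition shear_coord (A B : R) (c : coord) : term :=
  match c with
  | x1 => Var x1
  | x2 => Add (Mul (Cst A) (Var x1)) (Mul (Cst B) (Var x2))
  end.

Definition shear_jac (A B : R) (k c : coord) : R :=
  match k, c with x1, x1 => 1 | x1, x2 => A | x2, x1 => 0 | x2, x2 => B end.

(** The coefficients of [M] are those of [N] pulled back along
    [(x1, x2) |-> (x1, A * x1 + B * x2)]. *)
Definition shear_related (M N : coord -> coord -> coord -> R) A B : Prop :=
  forall i j c, sum2 (fun k => M i j k * shear_jac A B k c) =
    sum2 (fun a => sum2 (fun b =>
      N a b c * shear_jac A B i a * shear_jac A B j b)).

(** The map fixes [x1] and is linear, so both sides carry the same factor [/ x1] and second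
    derivatives drop out. The condition no longer depends on the point and can be read off at (1,
    0). *)
Lemma linearly_equivalent_shear M N :
  linearly_equivalent M N <->
  exists A B, B <> 0 /\ shear_related M N A B.
Proof.
  assert (dfd : forall A B c p, defined (shear_coord A B c) p)
    by (intros A B [] p; simpl; auto).
  assert (key : forall A B i j c p, half_plane p ->
    let phi := fun p => (fst p, A * fst p + B * snd p) in
    (sum2 (fun k => nabla M i j k p * dd k (fun q => comp c (phi q)) p)
    = dd i (dd j (fun q => comp c (phi q))) p
      + sum2 (fun a => sum2 (fun b =>
          nabla N a b c (phi p)
          * dd i (fun q => comp a (phi q)) p
          * dd j (fun q => comp b (phi q)) p))) <->
    / fst p * (sum2 (fun k => M i j k * shear_jac A B k c)) =
    / fst p * (sum2 (fun a => sum2 (fun b =>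
      N a b c * shear_jac A B i a * shear_jac A B j b)))).
  { intros A B i j c p Hp phi.
    assert (Ephi : forall c, (fun q => comp c (phi q)) = eval (shear_coord A B c))
      by (intros []; reflexivity).
    assert (Dphi : forall k c, dd k (fun q => comp c (phi q)) p
                   = shear_jac A B k c).
    { intros k c'; rewrite Ephi, dd_eval by auto.
      destruct k, c'; simpl; ring. }
    assert (DDphi : dd i (dd j (fun q => comp c (phi q))) p = 0).
    { rewrite Ephi, dd_dd_eval by auto; destruct i, j, c; simpl; ring. }
    unfold nabla, typeB_conn, sum2; rewrite !Dphi, DDphi; simpl.
    split; intros H; [rewrite !Rmult_plus_distr_l | ]; lra. }
  split; intros (A & B & B0 & H); exists A, B; split; auto.
  - intros i j c; specialize (H i j c (1, 0) Rlt_0_1).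
    apply key in H; [|apply Rlt_0_1]; simpl fst in H; lra.
  - intros i j c p Hp; apply key; auto; now rewrite H.
Qed.

Lemma typeA_criterion (M : typeB) :
  M x1 x2 x1 = 0 -> M x2 x2 x1 = 0 -> M x2 x2 x2 = 0 -> is_typeA M.
Proof.
  intros c0 e0 g0 p Hp.
  assert (sym : forall k, M x2 x1 k = M x1 x2 k) by (intros; apply coef_sym).
  (* The chart is [(ln x1, x2 + s x1 + r x1 ln x1)] with [s], [r] chosen to
     remove the term [C_11^2]. *)
  assert (Hsr : exists s r,
    s * (2 * M x1 x2 x2 - M x1 x1 x1) + r = M x1 x1 x2 /\
    r * (2 * M x1 x2 x2 - M x1 x1 x1) = 0).
  (* In the resonant case a linear term cannot absorb [C_11^2], and [x1 ln x1] takes over. *)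
  { destruct (Req_dec (2 * M x1 x2 x2 - M x1 x1 x1) 0) as [Z|Z].
    - exists 0, (M x1 x1 x2); rewrite Z; lra.
    - exists (M x1 x1 x2 / (2 * M x1 x2 x2 - M x1 x1 x1)), 0.
      split; [field; auto | ring]. }
  destruct Hsr as (s & r & Hs & Hr).
  set (phi2 := Add (Var x2)
         (Add (Mul (Cst s) (Var x1)) (Mul (Cst r) (Mul (Var x1) LnX)))).
  set (psi2 := Add (Var x2) (Add (Mul (Cst (- s)) (Exp (Var x1)))
         (Mul (Cst (- r)) (Mul (Var x1) (Exp (Var x1)))))).
  set (phi i := match i with x1 => LnX | x2 => phi2 end).
  set (psi i := match i with x1 => Exp (Var x1) | x2 => psi2 end).
  exists half_plane, (fun _ => True), (fun q => (eval (phi x1) q, eval (phi x2)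
    q)),
    (fun q => (eval (psi x1) q, eval (psi x2) q)),
    (fun i j k => match i, j, k with
       | x1, x1, x1 => M x1 x1 x1 + 1
       | x1, x2, x2 | x2, x1, x2 => M x1 x2 x2
       | _, _, _ => 0 end).
  split; [apply open_half_plane|]; split; [apply open_true|].
  split; [assumption|]; split; [auto|].
  assert (dphi : forall i q, half_plane q -> defined (phi i) q)
    by (intros [] q Hq; simpl; auto).
  split.
  - split; [|split; [|split]].
    + intros i; replace (fun q => _) with (eval (phi i)) by (destruct i;
      reflexivity).
      apply smooth_eval; auto.
    + intros i; replace (fun q => _) with (eval (psi i)) by (destruct i;
      reflexivity).
      apply smooth_eval; intros q _; destruct i; simpl; auto.
    + intros [u v] Hq; split; auto; unfold half_plane in Hq; simpl in *.
      rewrite exp_ln by assumption; f_equal; ring.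
    + intros [u v] _; simpl; split; [apply exp_pos|].
      rewrite ln_exp; f_equal; ring.
  - intros i j c q Hq.
    assert (Ephi : forall c, (fun q => comp c (eval (phi x1) q, eval (phi x2) q))
              = eval (phi c)) by (intros []; reflexivity).
    assert (Dphi : forall k c, dd k (fun q => comp c (eval (phi x1) q,
        eval (phi x2) q)) q = eval (D k (phi c)) q).
    { intros k c'; rewrite Ephi, dd_eval by auto; reflexivity. }
    rewrite Ephi, dd_dd_eval by auto.
    unfold sum2; cbv beta; rewrite !Dphi, !dd_eval by auto.
    assert (Hx : fst q <> 0) by apply Rgt_not_eq, Hq.
    unfold nabla, typeB_conn.
    destruct i, j, c; simpl; rewrite ?sym, ?c0, ?e0, ?g0; field_simplify_eq; auto.
    assert (Hr' : r * (2 * M x1 x2 x2 - M x1 x1 x1)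
                  * (fst q * (ln (fst q) + 1)) = 0) by (rewrite Hr; ring).
    rewrite <- Hs; lra.
Qed.

(** * Normal form of surfaces with a power solution *)

Lemma E_eval mu (M : typeB) t :
  (forall p, half_plane p -> defined t p) ->
  (forall i j p, half_plane p ->
     eval (D i (D j t)) p =
       sum2 (fun k => / fst p * M i j k * eval (D k t) p)
       + mu * eval t p * (/ fst p ^ 2 * rho0 M i j)) ->
  E mu M (eval t).
Proof.
  intros Ht H; split; [now apply smooth_eval|].
  intros i j p Hp; unfold hessian, nabla, sum2; cbv beta.
  rewrite ricci_sym_typeB, dd_dd_eval, !dd_eval, H by auto.
  unfold sum2, typeB_conn; ring.
Qed.

Definition power (al : R) : term := Exp (Mul (Cst al) LnX).

Lemma E_power mu (M : typeB) al : power_solution M mu al -> E mu M (eval (power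
  al)).
Proof.
  intros (H1 & H2 & H3); apply E_eval; [simpl; auto|].
  assert (sym : forall k, M x2 x1 k = M x1 x2 k) by (intros; apply coef_sym).
  assert (rsym : rho0 M x2 x1 = rho0 M x1 x2) by (unfold rho0; ring).
  intros i j p Hp; assert (Hx : fst p <> 0) by apply Rgt_not_eq, Hp.
  transitivity (sum2 (fun k => / fst p * M i j k * eval (D k (power al)) p)
     + eval (power al) p * / fst p ^ 2 * (mu * rho0 M i j)); [|ring].
  destruct i, j; rewrite ?rsym, <- ?H1, <- ?H2, <- ?H3; unfold sum2; simpl;
    rewrite ?sym; field; auto.
Qed.

Lemma shear_related_coefs (M N : coord -> coord -> coord -> R) A B :
  (forall k, N x2 x1 k = N x1 x2 k) -> B <> 0 -> shear_related M N A B ->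
  M x1 x1 x1 = N x1 x1 x1 + 2 * A * N x1 x2 x1 + A ^ 2 * N x2 x2 x1 /\
  M x1 x2 x1 = B * (N x1 x2 x1 + A * N x2 x2 x1) /\
  M x2 x2 x1 = B ^ 2 * N x2 x2 x1 /\
  M x1 x1 x2 = (N x1 x1 x2 + 2 * A * N x1 x2 x2 + A ^ 2 * N x2 x2 x2
    - A * (N x1 x1 x1 + 2 * A * N x1 x2 x1 + A ^ 2 * N x2 x2 x1)) / B /\
  M x1 x2 x2 = N x1 x2 x2 + A * N x2 x2 x2
    - A * (N x1 x2 x1 + A * N x2 x2 x1) /\
  M x2 x2 x2 = B * (N x2 x2 x2 - A * N x2 x2 x1).
Proof.
  intros sym B0 H.
  assert (H1 : forall i j, M i j x1 = sum2 (fun a => sum2 (fun b =>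
      N a b x1 * shear_jac A B i a * shear_jac A B j b))).
  { intros i j; rewrite <- H; unfold sum2; simpl; ring. }
  assert (H2 : forall i j, M i j x2 = (sum2 (fun a => sum2 (fun b =>
      N a b x2 * shear_jac A B i a * shear_jac A B j b)) - A * M i j x1) / B).
  { intros i j; rewrite <- H; unfold sum2; simpl; field; auto. }
  rewrite !H2, !H1; unfold sum2; simpl; rewrite !sym.
  repeat split; field; auto.
Qed.

(** The Ricci tensor is natural, so [rho0] pulls back as a symmetric bilinear form under the
    Jacobian of the shear. *)
Lemma rho0_shear (M N : coord -> coord -> coord -> R) A B :
  (forall k, M x2 x1 k = M x1 x2 k) -> (forall k, N x2 x1 k = N x1 x2 k) ->
  B <> 0 -> shear_related M N A B ->
  rho0 M x1 x1 = rho0 N x1 x1 + 2 * A * rho0 N x1 x2 + A ^ 2 * rho0 N x2 x2 /\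
  rho0 M x1 x2 = B * (rho0 N x1 x2 + A * rho0 N x2 x2) /\
  rho0 M x2 x2 = B ^ 2 * rho0 N x2 x2.
Proof.
  intros symM symN B0 H.
  destruct (rho0_coefs M symM) as (-> & -> & _ & ->).
  destruct (rho0_coefs N symN) as (-> & -> & _ & ->).
  destruct (shear_related_coefs M N A B symN B0 H)
    as (-> & -> & -> & -> & -> & ->).
  repeat split; field; auto.
Qed.

Lemma rho0_zero_shear (M N : coord -> coord -> coord -> R) A B :
  (forall k, M x2 x1 k = M x1 x2 k) -> (forall k, N x2 x1 k = N x1 x2 k) ->
  B <> 0 -> shear_related M N A B -> rho0_zero N -> rho0_zero M.
Proof.
  intros symM symN B0 H Z.
  destruct (rho0_shear M N A B) as (R1 & R2 & R3); auto.
  intros [] []; [rewrite R1 | rewrite R2 | |rewrite R3]; rewrite ?Z; try ring.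
  destruct (rho0_coefs M symM) as (_ & _ & -> & _).
  rewrite R2, !Z; ring.
Qed.

(** The shear preserves [x1] and hence [x1 ^ al]. Concretely, the equations for [M] are an
    invertible triangular combination of those for [N]. *)
Lemma power_solution_shear (M N : typeB) mu al A B :
  B <> 0 -> shear_related M N A B ->
  power_solution M mu al <-> power_solution N mu al.
Proof.
  intros B0 H; unfold power_solution.
  destruct (rho0_shear M N A B) as (-> & -> & ->); auto using coef_sym.
  destruct (shear_related_coefs M N A B) as (-> & -> & -> & _);
    auto using coef_sym.
  split; intros (H1 & H2 & H3).
  - assert (N3 : - N x2 x2 x1 * al = mu * rho0 N x2 x2).
    { apply Rmult_eq_reg_l with (B ^ 2); [lra | now apply pow_nonzero]. }
    assert (N2 : - N x1 x2 x1 * al = mu * rho0 N x1 x2).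
    { apply Rmult_eq_reg_l with B; auto.
      apply (f_equal (Rmult (B * A))) in N3; lra. }
    repeat split; auto.
    apply (f_equal (Rmult (A ^ 2))) in N3.
    apply (f_equal (Rmult (2 * A))) in N2; lra.
  - repeat split.
    + apply (f_equal (Rmult (A ^ 2))) in H3.
      apply (f_equal (Rmult (2 * A))) in H2; lra.
    + apply (f_equal (Rmult (B * A))) in H3.
      apply (f_equal (Rmult B)) in H2; lra.
    + apply (f_equal (Rmult (B ^ 2))) in H3; lra.
Qed.

Lemma shear_exists (M : typeB) A B : B <> 0 -> ~ rho0_zero M ->
  exists N : typeB, shear_related M N A B.
Proof.
  intros B0 rho_neq.
  (* The Jacobian of the inverse shear, along which the coefficients of [M] are transported to
     [N]. *)
  set (J i a := shear_jac (- A / B) (/ B) i a).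
  set (pull c i j := sum2 (fun a => sum2 (fun b => M a b c * J i a * J j b))).
  set (N i j c := match c with
                  | x1 => pull x1 i j
                  | x2 => B * pull x2 i j + A * pull x1 i j end).
  assert (symN : forall i j k, N i j k = N j i k).
  { assert (P : forall c i j, pull c i j = pull c j i).
    { intros c i j; unfold pull, sum2; rewrite (coef_sym M x2 x1); ring. }
    intros i j []; unfold N; now rewrite ?(P _ i j). }
  assert (MN : shear_related M N A B).
  { intros i j c; unfold N, pull, J, sum2.
    destruct i, j, c; simpl; rewrite ?(coef_sym M x2 x1); field; auto. }
  assert (nf : ~ flat_on half_plane (typeB_conn N)).
  { intros F; apply rho_neq.
    apply (rho0_zero_shear M N A B); auto using coef_sym.
    intros i j; destruct (Req_dec (rho0 N i j) 0); auto.
    exfalso; revert F; now apply not_flat_of_rho0 with i j. }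
  now exists (TypeB N symN nf).
Qed.

Lemma shear_normal_form (M : typeB) : M x2 x2 x1 <> 0 -> ~ rho0_zero M ->
  exists (N : typeB) eps A B, (eps = 1 \/ eps = -1) /\ B <> 0 /\
    shear_related M N A B /\ N x1 x2 x1 = 0 /\ N x2 x2 x1 = eps.
Proof.
  intros e0 rho_neq.
  set (B := sqrt (Rabs (M x2 x2 x1))).
  assert (HB : B * B = Rabs (M x2 x2 x1)) by apply sqrt_sqrt, Rabs_pos.
  assert (Heps : exists eps, (eps = 1 \/ eps = -1) /\ eps * (B * B) = M x2 x2 x1).
  { rewrite HB; unfold Rabs; destruct (Rcase_abs _).
    - exists (-1); split; auto; ring.
    - exists 1; split; auto; ring. }
  destruct Heps as (eps & Heps & He).
  assert (B0 : B <> 0) by (intros Z; rewrite Z in He; apply e0; rewrite <- He;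
    ring).
  assert (eps0 : eps <> 0) by lra.
  (* [B ^ 2] scales [C_22^1] to a sign; this slope then solves [C_12^1 = B * A * eps], which makes
     the new [C_12^1] zero. *)
  destruct (shear_exists M (M x1 x2 x1 / (B * eps)) B B0 rho_neq) as (N & HN).
  exists N, eps, (M x1 x2 x1 / (B * eps)), B.
  destruct (shear_related_coefs M N _ B (coef_sym N x2 x1) B0 HN)
    as (_ & Hc & He' & _).
  assert (eN : N x2 x2 x1 = eps).
  { apply Rmult_eq_reg_l with (B * B); [lra|].
    now apply Rmult_integral_contrapositive. }
  repeat split; auto.
  rewrite eN in Hc; apply Rmult_eq_reg_l with B; auto.
  apply Rplus_eq_reg_r with (M x1 x2 x1).
  rewrite Hc at 2; field; auto.
Qed.

(** With [C_12^1 = 0] the second power equation gives [rho0 N x1 x2 = 0], hence [C_22^2]; the third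
    gives [al], and the first then gives the formula for [mu]. If [C_11^1 - C_12^2 - 1] were zero,
    so would be [al] and all of [rho0]. *)
Lemma power_solution_normal (N : typeB) mu al eps :
  (eps = 1 \/ eps = -1) -> mu <> 0 -> ~ rho0_zero N ->
  N x1 x2 x1 = 0 -> N x2 x2 x1 = eps -> power_solution N mu al ->
  N x2 x2 x2 = 2 * eps * N x1 x1 x2 /\
  N x1 x1 x1 - N x1 x2 x2 - 1 <> 0 /\
  al = - mu * (N x1 x1 x1 - N x1 x2 x2 - 1) /\
  mu * (N x1 x1 x1 - N x1 x2 x2 - 1) ^ 2 =
    - (N x1 x1 x1) ^ 2 + 2 * N x1 x1 x1 * N x1 x2 x2
    + 2 * eps * (N x1 x1 x2) ^ 2 - (N x1 x2 x2) ^ 2 + 2 * N x1 x2 x2 + 1.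
Proof.
  intros Heps mu0 rho_neq c e (P1 & P2 & P3).
  destruct (rho0_coefs N (coef_sym N x2 x1)) as (r11 & r12 & r21 & r22).
  rewrite c, e in *.
  assert (eps2 : eps * eps = 1) by (destruct Heps as [-> | ->]; ring).
  assert (Z12 : rho0 N x1 x2 = 0) by (apply Rmult_eq_reg_l with mu; lra).
  assert (g : N x2 x2 x2 = 2 * eps * N x1 x1 x2) by lra.
  assert (Hal : al = - mu * (N x1 x1 x1 - N x1 x2 x2 - 1)).
  { apply Rmult_eq_reg_l with eps; [|lra]; rewrite r22 in P3; lra. }
  split; [assumption|]; split; [|split; [assumption|]].
  - intros t0; rewrite t0 in Hal; apply rho_neq.
    assert (al0 : al = 0) by lra; rewrite al0 in *.
    assert (Z11 : rho0 N x1 x1 = 0) by (apply Rmult_eq_reg_l with mu; lra).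
    assert (Z22 : rho0 N x2 x2 = 0) by (apply Rmult_eq_reg_l with mu; lra).
    intros [] []; rewrite ?r21; auto.
  - apply Rmult_eq_reg_l with mu; auto.
    rewrite r11, Hal, g in P1; lra.
Qed.

Lemma normal_power_solution (N : typeB) mu eps :
  N x1 x2 x1 = 0 -> N x2 x2 x1 = eps ->
  N x2 x2 x2 = 2 * eps * N x1 x1 x2 ->
  mu * (N x1 x1 x1 - N x1 x2 x2 - 1) ^ 2 =
    - (N x1 x1 x1) ^ 2 + 2 * N x1 x1 x1 * N x1 x2 x2
    + 2 * eps * (N x1 x1 x2) ^ 2 - (N x1 x2 x2) ^ 2 + 2 * N x1 x2 x2 + 1 ->
  power_solution N mu (- mu * (N x1 x1 x1 - N x1 x2 x2 - 1)).
Proof.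
  intros c e g H; unfold power_solution.
  destruct (rho0_coefs N (coef_sym N x2 x1)) as (-> & -> & _ & ->).
  rewrite c, e, g; repeat split; try field.
  apply (f_equal (Rmult mu)) in H; lra.
Qed.

(** * Surfaces with two independent solutions *)

(** The form vanishing on the jets of the multiples of [x1 ^ al], written in
    the coordinates [(x1, A * x1 + B * x2)]. *)
Definition slanted (A B al : R) (v : vec) : R :=
  B * v1 v - A * v2 v - al * B * v0 v.

(** [Y] and [v2] are coordinates on the quotient of jets by the line of (1, al, 0). The maps [trans]
    preserve this line and so act on the quotient; the power equations eliminate [mu * rho0]. *)
Lemma slanted_identities (M N : typeB) mu al A B :
  let e := N x2 x2 x1 in let b := N x1 x1 x2 in let d := N x1 x2 x2 in
  let tau := N x1 x1 x1 - d - 1 - al in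
  let Y := slanted A B al in
  B <> 0 -> shear_related M N A B -> N x1 x2 x1 = 0 ->
  N x2 x2 x2 = 2 * e * b -> power_solution M mu al ->
  forall v,
  v2 (bracket_defect M mu v) = B * e * (tau * Y v - b * v2 v) /\
  Y (trans M mu x2 v) = B * (d - al) * v2 v /\
  v2 (trans M mu x2 v) = B * e * (Y v + 2 * b * v2 v) /\
  Y (trans M mu x1 v) = (tau + d + 2) * Y v + b * v2 v + A * (d - al) * v2 v /\
  v2 (trans M mu x1 v) = (d + 1) * v2 v + A * e * (Y v + 2 * b * v2 v).
Proof.
  intros e b d tau Y B0 MN c g (P1 & P2 & P3) v.
  assert (symM : forall k, M x2 x1 k = M x1 x2 k) by (intros; apply coef_sym).
  destruct (rho0_coefs M symM) as (_ & _ & r21 & _).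
  destruct (shear_related_coefs M N A B (coef_sym N x2 x1) B0 MN)
    as (M111 & M121 & M221 & M112 & M122 & M222).
  unfold bracket_defect, trans, sum2, Y, slanted; simpl.
  rewrite !symM, !r21, <- P1, <- P2, <- P3.
  rewrite M111, M121, M221, M112, M122, M222, c, g.
  unfold tau, d, b, e.
  repeat split; field; auto.
Qed.

(** Any point is joined to (1, 0) by a vertical and then a horizontal segment inside the half
    plane. *)
Lemma half_plane_constant (h : R * R -> R) :
  (forall i p, half_plane p ->
     is_derive (fun s => h (slice i p s)) (comp i p) 0) ->
  forall p, half_plane p -> h p = h (1, 0).
Proof.
  intros H.
  assert (H2 : forall u, 0 < u -> forall v w, v < w -> h (u, v) = h (u, w)).
  { intros u Hu v w Hvw; apply (eq_is_derive (fun s => h (u, s))); auto.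
    intros s _; exact (H x2 (u, s) Hu). }
  assert (H1 : forall v u w, 0 < u -> u < w -> h (u, v) = h (w, v)).
  { intros v u w Hu Huw; apply (eq_is_derive (fun s => h (s, v))); auto.
    intros s [Hs _]; apply (H x1 (s, v)).
    unfold half_plane; simpl; lra. }
  intros [u v] Hu; unfold half_plane in Hu; simpl in Hu.
  transitivity (h (u, 0)).
  - destruct (Rtotal_order v 0) as [Hv|[->|Hv]]; auto.
    symmetry; auto.
  - destruct (Rtotal_order u 1) as [H'|[->|H']]; auto.
    symmetry; apply H1; auto; lra.
Qed.

Lemma eval_power_opp al p : eval (power (- al)) p * eval (power al) p = 1.
Proof. simpl; rewrite <- exp_plus, <- exp_0; f_equal; ring. Qed.

Lemma eval_power_S al p : half_plane p ->
  eval (power (al + 1)) p = fst p * eval (power al) p.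
Proof.
  intros Hp; simpl; rewrite Rmult_plus_distr_r, exp_plus, Rmult_1_l, exp_ln.
  - ring.
  - exact Hp.
Qed.

(** The product of [phi (jet f)] with [x1 ^ (- al)] has zero partial derivatives, and the power
    equals 1 at the base point (1, 0). *)
Lemma form_power_law phi mu (M : typeB) f al :
  linear_form phi -> E mu M f ->
  (forall p, half_plane p -> phi (trans M mu x1 (jet f p)) = al * phi (jet f
    p)) ->
  (forall p, half_plane p -> phi (trans M mu x2 (jet f p)) = 0) ->
  forall p, half_plane p ->
    phi (jet f p) = phi (jet f (1, 0)) * eval (power al) p.
Proof.
  intros Hphi Ef F1 F2 p Hp.
  set (h q := phi (jet f q) * eval (power (- al)) q).
  assert (Hh : h p = h (1, 0)).
  { apply half_plane_constant; auto.
    intros i q Hq; assert (Hx : fst q <> 0) by apply Rgt_not_eq, Hq.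
    assert (G1 := is_derive_form phi mu M f i q Hphi Ef Hq).
    assert (G2 := is_derive_eval i (power (- al)) q (conj I Hq)).
    generalize (is_derive_mult _ _ _ _ _ G1 G2 Rmult_comm).
    unfold h; rewrite slice_comp; destruct i; rewrite ?F1, ?F2 by assumption.
    - match goal with |- is_derive _ _ ?a -> is_derive _ _ _ =>
        replace a with 0; auto end.
      simpl; unfold plus, mult; simpl; field; auto.
    - match goal with |- is_derive _ _ ?a -> is_derive _ _ _ =>
        replace a with 0; auto end.
      simpl; unfold plus, mult; simpl; field; auto. }
  unfold h in Hh.
  transitivity (phi (jet f p) * eval (power (- al)) p * eval (power al) p).
  - rewrite Rmult_assoc, eval_power_opp; ring.
  - rewrite Hh; f_equal; simpl; rewrite ln_1, Rmult_0_r, exp_0; ring.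
Qed.

(** The coefficients for which [x1 ^ C_12^2] and
    [x1 ^ C_12^2 * (x2 - 2 * C_11^2 * x1)] are solutions. *)
Definition two_solutions (N : coord -> coord -> coord -> R) mu eps : Prop :=
  let t := N x1 x1 x1 - N x1 x2 x2 - 1 in
  N x1 x2 x1 = 0 /\ N x2 x2 x1 = eps /\
  N x2 x2 x2 = 2 * eps * N x1 x1 x2 /\
  power_solution N mu (N x1 x2 x2) /\ N x1 x2 x2 = - mu * t /\ t <> 0 /\
  N x1 x1 x2 * (2 * (1 + mu) * t + 1) = 0.

Definition second_solution A B al s : term :=
  Mul (power al) (Add (Mul (Cst B) (Var x2)) (Mul (Cst (A - 2 * s)) (Var x1))).

Lemma E_second_solution (M N : typeB) mu eps A B :
  B <> 0 -> shear_related M N A B -> two_solutions N mu eps ->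
  E mu M (eval (second_solution A B (N x1 x2 x2) (N x1 x1 x2))).
Proof.
  intros B0 MN (c & e & g & P & al & t0 & Hb).
  apply (power_solution_shear M N mu _ A B B0 MN) in P.
  destruct P as (P1 & P2 & P3); apply E_eval; [simpl; auto|].
  assert (sym : forall k, M x2 x1 k = M x1 x2 k) by (intros; apply coef_sym).
  assert (rsym : rho0 M x2 x1 = rho0 M x1 x2) by (unfold rho0; ring).
  destruct (shear_related_coefs M N A B (coef_sym N x2 x1) B0 MN)
    as (M111 & M121 & M221 & M112 & M122 & M222).
  rewrite c, e, g in *.
  set (d := N x1 x2 x2) in *; set (b := N x1 x1 x2) in *.
  assert (Hb' : b * (1 - 2 * N x1 x1 x1 + 4 * d) = 0).
  { transitivity (- (b * (2 * (1 + mu) * (N x1 x1 x1 - d - 1) + 1)));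
      [|rewrite Hb; ring].
    transitivity (- (b * (2 * (N x1 x1 x1 - d - 1)
       - 2 * (- mu * (N x1 x1 x1 - d - 1)) + 1))); [rewrite <- al|]; ring. }
  intros i j p Hp; assert (Hx : fst p <> 0) by apply Rgt_not_eq, Hp.
  set (f := second_solution A B d b).
  transitivity (sum2 (fun k => / fst p * M i j k * eval (D k f) p)
     + eval f p * / fst p ^ 2 * (mu * rho0 M i j)); [|ring].
  destruct i, j; rewrite ?rsym, <- ?P1, <- ?P2, <- ?P3; unfold sum2; simpl;
    rewrite ?sym, ?M111, ?M121, ?M221, ?M112, ?M122, ?M222.
  (* Only the (x1, x1) component imposes a condition, namely [Hb']. *)
  2,3,4: field; auto.
  apply Rminus_diag_uniq.
  transitivity (- (b * (1 - 2 * N x1 x1 x1 + 4 * d))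
    * (/ fst p * exp (d * ln (fst p)))); [field; auto | rewrite Hb'; ring].
Qed.

(** The bracket relation forces [Y = - 2 * b * v2] on jets, so [x1 d_2 f] is a constant times
    [x1 ^ (d + 1)]. After subtracting the matching multiple of the second solution, the quotient of
    [f] by [x1 ^ d] is constant. *)
Lemma E_combination (M N : typeB) mu eps A B f :
  eps <> 0 -> mu <> -1 -> B <> 0 -> shear_related M N A B ->
  two_solutions N mu eps -> E mu M f ->
  exists c0 c1, forall p, half_plane p ->
    f p = c0 * eval (power (N x1 x2 x2)) p
          + c1 * eval (second_solution A B (N x1 x2 x2) (N x1 x1 x2)) p.
Proof.
  intros eps0 mu1 B0 MN (c & e & g & P & al & t0 & Hb) Ef.
  apply (power_solution_shear M N mu _ A B B0 MN) in P.
  assert (Id := slanted_identities M N mu (N x1 x2 x2) A B B0 MN c).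
  rewrite e in Id; specialize (Id g P).
  set (d := N x1 x2 x2) in *; set (b := N x1 x1 x2) in *.
  set (tau := N x1 x1 x1 - d - 1 - d) in *.
  assert (Htau : tau = (1 + mu) * (N x1 x1 x1 - d - 1)).
  { unfold tau; rewrite al at 2; ring. }
  assert (tau0 : tau <> 0).
  { rewrite Htau; apply Rmult_integral_contrapositive; split; lra. }
  assert (Hb' : b * (1 + 2 * tau) = 0) by (rewrite Htau; lra).
  assert (HY : forall p, half_plane p ->
    slanted A B d (jet f p) + 2 * b * v2 (jet f p) = 0).
  { intros p Hp; destruct (Id (jet f p)) as (I1 & _).
    rewrite (bracket_defect_jet mu M f p Ef Hp) in I1; simpl v2 at 1 in I1.
    symmetry in I1; apply Rmult_integral in I1; destruct I1 as [I1|I1].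
    - apply Rmult_integral in I1; destruct I1; contradiction.
    - apply Rmult_eq_reg_l with tau; auto.
      transitivity (tau * slanted A B d (jet f p) - b * v2 (jet f p)
        + b * (1 + 2 * tau) * v2 (jet f p)); [ring|].
      rewrite I1, Hb'; ring. }
  set (q0 := v2 (jet f (1, 0))).
  assert (Hq : forall p, half_plane p ->
    xd x2 f p = q0 * (fst p * eval (power d) p)).
  { intros p Hp; rewrite <- eval_power_S by assumption.
    apply (form_power_law v2 mu M f (d + 1)); auto.
    - exact (linear_form_vcomp x2).
    - intros q Hq; destruct (Id (jet f q)) as (_ & _ & _ & _ & ->).
      rewrite HY by assumption; ring.
    - intros q Hq; destruct (Id (jet f q)) as (_ & _ & -> & _).
      rewrite HY by assumption; ring. }
  set (ell := Add (Mul (Cst B) (Var x2)) (Mul (Cst (A - 2 * b)) (Var x1))).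
  set (h p := f p * eval (power (- d)) p - q0 / B * eval ell p).
  assert (Hh : forall p, half_plane p -> h p = h (1, 0)).
  { apply half_plane_constant; intros i p Hp.
    assert (Hx : fst p <> 0) by apply Rgt_not_eq, Hp.
    assert (Hf := proj1 (is_derive_jet mu M f i p Ef Hp)).
    assert (G2 := is_derive_eval i (power (- d)) p (conj I Hp)).
    assert (G3 := is_derive_eval i (Mul (Cst (q0 / B)) ell) p
                    (conj I (conj (conj I I) (conj I I)))).
    generalize (is_derive_minus _ _ _ _ _
       (is_derive_mult _ _ _ _ _ Hf G2 Rmult_comm) G3).
    unfold h; rewrite slice_comp; simpl v0.
    assert (Hpp := eval_power_opp d p).
    match goal with |- is_derive _ _ ?a -> is_derive _ _ _ =>
      replace a with 0; auto end.
    assert (HYp := HY p Hp); unfold slanted in HYp.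
    destruct i.
    - assert (Hp1 : xd x1 f p =
          d * f p + (A - 2 * b) / B * (q0 * (fst p * eval (power d) p))).
      { rewrite <- Hq by assumption; apply Rmult_eq_reg_l with B; auto.
        simpl in HYp; field_simplify; auto; lra. }
      unfold minus, plus, opp, mult; simpl vcomp; rewrite Hp1.
      simpl in *; unfold plus, opp, mult; simpl.
      transitivity ((A - 2 * b) * q0 / B *
         (exp (- d * ln (fst p)) * exp (d * ln (fst p)) - 1));
        [rewrite Hpp; ring | field; auto].
    - unfold minus, plus, opp, mult; simpl vcomp; rewrite Hq by assumption.
      simpl in *; unfold plus, opp, mult; simpl.
      transitivity (q0 * (exp (- d * ln (fst p)) * exp (d * ln (fst p)) - 1));
        [rewrite Hpp; ring | field; auto]. }
  exists (h (1, 0)), (q0 / B); intros p Hp.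
  rewrite <- (Hh p Hp); unfold h; change (eval (second_solution A B d b) p)
    with (eval (power d) p * eval ell p).
  transitivity (f p * (eval (power (- d)) p * eval (power d) p));
    [rewrite eval_power_opp; ring | ring].
Qed.

Lemma has_dim_two_solutions (M N : typeB) mu eps A B :
  eps <> 0 -> mu <> -1 -> B <> 0 -> shear_related M N A B ->
  two_solutions N mu eps -> has_dim (E mu M) 2.
Proof.
  intros eps0 mu1 B0 MN H.
  set (f1 := eval (second_solution A B (N x1 x2 x2) (N x1 x1 x2))).
  set (f0 := eval (power (N x1 x2 x2))).
  exists (fun i => match i with O => f0 | _ => f1 end).
  split; [|split].
  - intros [|i] _.
    + apply E_power, (power_solution_shear M N mu _ A B B0 MN), H.
    + now apply E_second_solution with eps.
  - intros c Hc.
    (* On the line [x1 = 1] the power is 1, so the two values differ by [c 1 * B]. *)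
    generalize (Hc (1, 0) Rlt_0_1) (Hc (1, 1) Rlt_0_1).
    unfold f0, f1; simpl; rewrite ln_1, Rmult_0_r, exp_0; intros Z0 Z1.
    assert (C1 : c 1%nat = 0).
    { apply Rmult_eq_reg_r with B; lra. }
    intros [|[|i]] Hi; auto.
    + rewrite C1 in Z0; lra.
    + exfalso; do 2 apply PeanoNat.Nat.succ_lt_mono in Hi; inversion Hi.
  - intros f Ef.
    destruct (E_combination M N mu eps A B f) as (c0 & c1 & Hf); auto.
    exists (fun i => match i with O => c0 | _ => c1 end).
    intros p Hp; simpl lincomb; rewrite Hf by assumption; unfold f0, f1; ring.
Qed.

(** * From the dimension to the normal forms *)

Lemma dim_ge_nonzero mu M : dim_ge (E mu M) 1 ->
  exists w, jet_space mu M w /\ w <> vzero.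
Proof.
  intros (b & Eb & ind).
  destruct (classic (forall p, half_plane p -> b O p = 0)) as [Z|Z].
  - exfalso; apply R1_neq_R0.
    apply (ind (fun _ => 1)) with (i := O); auto.
    intros p Hp; simpl; rewrite Z by assumption; ring.
  - apply not_all_ex_not in Z; destruct Z as [p Z].
    apply imply_to_and in Z; destruct Z as [Hp Z].
    exists (jet (b O) p); split.
    + apply jet_space_jet; auto.
    + intros H; apply Z; exact (f_equal v0 H).
Qed.

Lemma has_dim_dim_ge W n m : (m <= n)%nat -> has_dim W n -> dim_ge W m.
Proof.
  intros Hm (b & Wb & ind & _); exists b; split.
  - intros i Hi; apply Wb; now apply PeanoNat.Nat.lt_le_trans with m.
  - intros c Hc i Hi.
    (* Padding by zeros turns a relation among the first [m] functions into one among all [n]. *)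
    set (c' j := if Compare_dec.lt_dec j m then c j else 0).
    assert (Hl : forall k p, lincomb k c' b p =
      lincomb (Nat.min k m) c b p).
    { induction k as [|k IH]; intros p; [reflexivity|].
      simpl lincomb at 1; rewrite IH; unfold c'.
      destruct (Compare_dec.lt_dec k m) as [L|L].
      - rewrite !PeanoNat.Nat.min_l by lia; reflexivity.
      - rewrite !PeanoNat.Nat.min_r by lia; ring. }
    assert (Z : c' i = 0).
    { apply (ind c'); [|lia].
      intros p Hp; rewrite Hl, PeanoNat.Nat.min_r by assumption; auto. }
    unfold c' in Z; destruct (Compare_dec.lt_dec i m); [assumption|lia].
Qed.

Lemma normal_form_exists (M : typeB) mu w :
  ~ is_typeA M -> ~ rho0_zero M -> mu <> 0 -> mu <> -1 ->
  jet_space mu M w -> w <> vzero ->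
  exists (N : typeB) eps A B, (eps = 1 \/ eps = -1) /\ B <> 0 /\
    shear_related M N A B /\ N x1 x2 x1 = 0 /\ N x2 x2 x1 = eps /\
    N x2 x2 x2 = 2 * eps * N x1 x1 x2 /\
    N x1 x1 x1 - N x1 x2 x2 - 1 <> 0 /\
    power_solution N mu (- mu * (N x1 x1 x1 - N x1 x2 x2 - 1)) /\
    mu * (N x1 x1 x1 - N x1 x2 x2 - 1) ^ 2 =
      - (N x1 x1 x1) ^ 2 + 2 * N x1 x1 x1 * N x1 x2 x2
      + 2 * eps * (N x1 x1 x2) ^ 2 - (N x1 x2 x2) ^ 2 + 2 * N x1 x2 x2 + 1.
Proof.
  intros notA rho_neq mu0 mu1 Ww w0.
  destruct (jet_space_power M mu w) as (e0 & al & P); auto.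
  { intros (c & e & g); apply notA; now apply typeA_criterion. }
  destruct (shear_normal_form M e0 rho_neq)
    as (N & eps & A & B & Heps & B0 & MN & c & e).
  apply (power_solution_shear M N mu al A B B0 MN) in P.
  destruct (power_solution_normal N mu al eps) as (g & t0 & Hal & Hmu); auto.
  { intros Z; apply rho_neq.
    apply (rho0_zero_shear M N A B); auto using coef_sym. }
  exists N, eps, A, B; rewrite <- Hal; repeat split; try apply P; auto.
Qed.

Lemma two_solutions_of_dim (M N : typeB) mu eps A B :
  let al := - mu * (N x1 x1 x1 - N x1 x2 x2 - 1) in
  eps <> 0 -> mu <> -1 -> B <> 0 -> shear_related M N A B ->
  N x1 x2 x1 = 0 -> N x2 x2 x1 = eps ->
  N x2 x2 x2 = 2 * eps * N x1 x1 x2 ->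
  N x1 x1 x1 - N x1 x2 x2 - 1 <> 0 ->
  power_solution N mu al -> dim_ge (E mu M) 2 -> two_solutions N mu eps.
Proof.
  intros al eps0 mu1 B0 MN c e g t0 PN (f & Ef & ind).
  assert (P := PN); apply (power_solution_shear M N mu al A B B0 MN) in P.
  assert (Id := slanted_identities M N mu al A B B0 MN c).
  rewrite e in Id; specialize (Id g P).
  set (d := N x1 x2 x2) in *; set (b := N x1 x1 x2) in *.
  set (tau := N x1 x1 x1 - d - 1 - al) in *.
  assert (Htau : tau = (1 + mu) * (N x1 x1 x1 - d - 1))
    by (unfold tau, al; ring).
  assert (tau0 : tau <> 0).
  { rewrite Htau; apply Rmult_integral_contrapositive; split; lra. }
  set (theta v := tau * slanted A B al v - b * v2 v).
  assert (Htheta : vanishing mu M theta).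
  { split.
    - intros v; unfold theta, slanted; simpl; ring.
    - intros h p Eh Hp; destruct (Id (jet h p)) as (I1 & _).
      rewrite (bracket_defect_jet mu M h p Eh Hp) in I1; simpl v2 at 1 in I1.
      symmetry in I1; apply Rmult_integral in I1; destruct I1 as [I1|I1]; auto.
      apply Rmult_integral in I1; destruct I1; contradiction. }
  assert (V1 := vanishing_trans mu M theta x1 Htheta).
  assert (V2 := vanishing_trans mu M theta x2 Htheta).
  (* Either some solution depends on the second coordinate, and differentiating [theta] at its jet
     yields the constraints, or every solution is a multiple of [x1 ^ al], against independence. *)
  destruct (classic (exists h p, E mu M h /\ half_plane p /\
                       v2 (jet h p) <> 0)) as [(h & p & Eh & Hp & q0)|Z].
  - apply proj2 in Htheta, V1, V2.
    specialize (Htheta h p Eh Hp); specialize (V1 h p Eh Hp);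
      specialize (V2 h p Eh Hp).
    destruct (Id (jet h p)) as (_ & I2 & I3 & I4 & I5).
    unfold theta in *; rewrite I4, I5 in V1; rewrite I2, I3 in V2.
    set (q := v2 (jet h p)) in *; set (Y := slanted A B al (jet h p)) in *.
    (* The relation [V2] divided by [B]. Subtracting [A] times it from [V1] removes the shear from
       that relation as well. *)
    assert (V2' : tau * (d - al) * q - b * eps * (Y + 2 * b * q) = 0).
    { apply Rmult_eq_reg_l with B; auto; lra. }
    assert (V1' : tau * ((tau + d + 2) * Y + b * q) - b * (d + 1) * q = 0).
    { transitivity (A * (tau * (d - al) * q - b * eps * (Y + 2 * b * q))
        + (tau * ((tau + d + 2) * Y + b * q) - b * (d + 1) * q));
        [rewrite V2'; ring | lra]. }
    assert (HY : tau * Y = b * q) by lra.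
    assert (Hb : b * (2 * tau + 1) = 0).
    { apply Rmult_eq_reg_r with q; auto.
      transitivity ((tau + d + 2) * (b * q) + tau * b * q - b * (d + 1) * q);
        [ring | rewrite <- HY; lra]. }
    assert (Hd : d = al).
    { apply Rmult_eq_reg_l with (tau * tau * q).
      2: apply Rmult_integral_contrapositive_currified; auto;
         now apply Rmult_integral_contrapositive_currified.
      apply Rminus_diag_uniq.
      transitivity (tau * (tau * (d - al) * q - b * eps * (Y + 2 * b * q))
        + b * eps * (tau * Y - b * q) + b * (2 * tau + 1) * (eps * b * q));
        [ring | rewrite V2', HY, Hb; ring]. }
    unfold two_solutions; fold d b.
    rewrite <- Hd in PN; repeat split; try apply PN; auto.
    rewrite <- Hb, Htau; ring.
  - exfalso.
    assert (Hq : forall h p, E mu M h -> half_plane p -> v2 (jet h p) = 0).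
    { intros h p Eh Hp; apply NNPP; intros q0; apply Z; now exists h, p. }
    assert (Hp1 : forall h p, E mu M h -> half_plane p ->
              v1 (jet h p) = al * v0 (jet h p)).
    { intros h p Eh Hp; generalize (proj2 Htheta h p Eh Hp) (Hq h p Eh Hp).
      unfold theta, slanted; intros H Z2; rewrite Z2 in H.
      apply Rmult_eq_reg_l with (tau * B); [lra|].
      now apply Rmult_integral_contrapositive. }
    assert (Hf : forall i p, (i < 2)%nat -> half_plane p ->
              f i p = f i (1, 0) * eval (power al) p).
    { intros i p Hi Hp; apply (form_power_law v0 mu M (f i) al); auto.
      - apply linear_form_v0.
      - intros r Hr; exact (Hp1 (f i) r (Ef i Hi) Hr).
      - intros r Hr; exact (Hq (f i) r (Ef i Hi) Hr). }
    assert (L0 : (0 < 2)%nat) by lia.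
    assert (L1 : (1 < 2)%nat) by lia.
    (* Both functions being multiples of [x1 ^ al], crossing their values at (1, 0) gives a linear
       relation; independence makes this value zero, and then the second function vanishes
       identically. *)
    assert (Hc : f 1%nat (1, 0) = 0).
    { apply (ind (fun i => match i with O => f 1%nat (1, 0)
                           | _ => - f O (1, 0) end)) with (i := O); auto.
      intros p Hp; simpl lincomb; rewrite (Hf O p), (Hf 1%nat p) by auto; ring. }
    apply R1_neq_R0.
    apply (ind (fun i => match i with O => 0 | _ => 1 end)) with (i := 1%nat);
      auto.
    intros p Hp; simpl lincomb; rewrite (Hf 1%nat p), Hc by auto; ring.
Qed.

(** With [t = a - d - 1] and [d = - mu * t], the first power equation becomes
    [(t + 2) * (t - d) = 2 * eps * b ^ 2]. If [b = 0] then [t = - 2], since [t = d] means [mu = -1].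
    Otherwise [d = t + 1/2], whence [t = - 2 - 4 * eps * b ^ 2]. *)
Lemma two_solutions_cases (N : typeB) mu eps :
  (eps = 1 \/ eps = -1) -> mu <> 0 -> mu <> -1 ->
  (two_solutions N mu eps <->
      ((N x1 x1 x1 = -1 + N x1 x2 x2 /\ N x1 x1 x2 = 0 /\ N x1 x2 x1 = 0 /\
        N x2 x2 x1 = eps /\ N x2 x2 x2 = 0 /\
        mu = / 2 * N x1 x2 x2 /\ / 2 * N x1 x2 x2 <> 0)
       \/
       (N x1 x1 x1 = - (/ 2) * (5 + 16 * eps * (N x1 x1 x2) ^ 2) /\
        N x1 x2 x1 = 0 /\
        N x1 x2 x2 = - (/ 2) * (3 + 8 * eps * (N x1 x1 x2) ^ 2) /\
        N x2 x2 x1 = eps /\ N x2 x2 x2 = 2 * eps * N x1 x1 x2 /\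
        mu = - ((3 + 8 * eps * (N x1 x1 x2) ^ 2)
                / (4 + 8 * eps * (N x1 x1 x2) ^ 2)) /\
        N x1 x1 x2 <> 0 /\
        (eps = -1 -> N x1 x1 x2 <> 1 / sqrt 2 /\ N x1 x1 x2 <> - (1 / sqrt 2))))).
Proof.
  intros Heps mu0 mu1.
  assert (eps0 : eps <> 0) by lra.
  assert (eps2 : eps * eps = 1) by (destruct Heps as [-> | ->]; ring).
  destruct (rho0_coefs N (coef_sym N x2 x1)) as (r11 & r12 & _ & r22).
  unfold two_solutions, power_solution; rewrite r11, r12, r22.
  clear r11 r12 r22.
  generalize (N x1 x1 x1) (N x1 x1 x2) (N x1 x2 x1) (N x1 x2 x2) (N x2 x2 x1)
    (N x2 x2 x2); clear N; intros a b c d e g; split.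
  - intros (-> & -> & -> & (P1 & _) & Hd & t0 & Hb).
    set (t := a - d - 1) in *.
    assert (Ha : a = t + d + 1) by (unfold t; ring); clearbody t; subst a.
    assert (d0 : d <> 0).
    { intros d0; rewrite d0 in Hd; symmetry in Hd.
      apply Rmult_integral in Hd; destruct Hd; lra. }
    assert (Q : (t + 2) * (t - d) = 2 * eps * b ^ 2).
    { apply Rmult_eq_reg_l with d; auto.
      assert (H : (t + 2) * d * t = (- mu * t) * (d * (t + 2) + 2 * eps * b ^ 2)).
      { apply (f_equal (Rmult t)) in P1; lra. }
      rewrite <- Hd in H; lra. }
    destruct (Req_dec b 0) as [-> | b0].
    + left.
      assert (t2 : t = - 2).
      { assert (Q' : (t + 2) * (t - d) = 0) by (rewrite Q; ring).
        apply Rmult_integral in Q'; destruct Q' as [Q'|Q']; [lra|].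
        exfalso; apply mu1.
        apply Rmult_eq_reg_r with t; auto; lra. }
      subst t; repeat split; try ring; lra.
    + right; apply Rmult_integral in Hb; destruct Hb as [Hb|Hb]; [contradiction|].
      assert (td : d = t + / 2) by lra; rewrite td in Q, Hd |- *.
      assert (Ht : t = - 2 - 4 * eps * b ^ 2) by lra.
      repeat split; auto; try (rewrite Ht; field).
      * apply Rmult_eq_reg_r with (- t); [|now apply Ropp_neq_0_compat].
        assert (D0 : 4 + 8 * eps * b ^ 2 <> 0) by (intros D0; apply t0; lra).
        rewrite Ht at 2; transitivity (- mu * t); [ring | rewrite <- Hd].
        rewrite Ht; field; auto.
      (* For [eps = -1], the excluded values of [b] are exactly those with [t = 0]. *)
      * intros Hb1; apply t0; rewrite Ht, H, Hb1.
        unfold Rdiv; rewrite Rmult_1_l, pow_inv, pow2_sqrt by lra; field.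
      * intros Hb1; apply t0; rewrite Ht, H, Hb1.
        unfold Rdiv;
          rewrite Rmult_1_l, <- Rsqr_pow2, <- Rsqr_neg, Rsqr_pow2, pow_inv, pow2_sqrt by lra; field.
  - intros [(-> & -> & -> & -> & -> & Hmu & d0) | (-> & -> & Hd & -> & -> & Hmu
    & b0 & Hb)].
    + assert (Hd : d = 2 * mu) by lra; rewrite Hd; repeat split; try field; lra.
    + assert (D0 : 4 + 8 * eps * b ^ 2 <> 0).
      { destruct Heps as [-> | ->]; [assert (H := pow2_ge_0 b); lra|].
        intros D0; destruct (Hb eq_refl) as [H1 H2].
        assert (S : (b - 1 / sqrt 2) * (b + 1 / sqrt 2) = 0).
        { transitivity (b ^ 2 - / (sqrt 2) ^ 2).
          - field; apply Rgt_not_eq, sqrt_lt_R0; lra.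
          - rewrite pow2_sqrt by lra; lra. }
        apply Rmult_integral in S; destruct S; [apply H1 | apply H2]; lra. }
      rewrite Hd, Hmu; repeat split; try (field; auto); lra.
Qed.

Theorem theorem1p17 (M : typeB) (mu : R)
    (notA : ~ is_typeA M) (rho_neq0 : ~ ricci_sym_zero M)
    (mu_neq0 : mu <> 0) (mu_neqN1 : mu <> -1) :
  (dim_ge (E mu M) 1 <->
    exists (N : typeB) (eps : R),
      (eps = 1 \/ eps = -1) /\ linearly_equivalent M N /\
      N x1 x2 x1 = 0 /\ N x2 x2 x1 = eps /\ N x2 x2 x2 = 2 * eps * N x1 x1 x2 /\
      N x1 x1 x1 - N x1 x2 x2 - 1 <> 0 /\
      mu = (- (N x1 x1 x1) ^ 2 + 2 * N x1 x1 x1 * N x1 x2 x2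
            + 2 * eps * (N x1 x1 x2) ^ 2 - (N x1 x2 x2) ^ 2
            + 2 * N x1 x2 x2 + 1)
           / (N x1 x1 x1 - N x1 x2 x2 - 1) ^ 2)
  /\
  (has_dim (E mu M) 2 <->
    exists (N : typeB) (eps : R),
      (eps = 1 \/ eps = -1) /\ linearly_equivalent M N /\
      ((N x1 x1 x1 = -1 + N x1 x2 x2 /\ N x1 x1 x2 = 0 /\ N x1 x2 x1 = 0 /\
        N x2 x2 x1 = eps /\ N x2 x2 x2 = 0 /\
        mu = / 2 * N x1 x2 x2 /\ / 2 * N x1 x2 x2 <> 0)
       \/
       (N x1 x1 x1 = - (/ 2) * (5 + 16 * eps * (N x1 x1 x2) ^ 2) /\
        N x1 x2 x1 = 0 /\
        N x1 x2 x2 = - (/ 2) * (3 + 8 * eps * (N x1 x1 x2) ^ 2) /\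
        N x2 x2 x1 = eps /\ N x2 x2 x2 = 2 * eps * N x1 x1 x2 /\
        mu = - ((3 + 8 * eps * (N x1 x1 x2) ^ 2)
                / (4 + 8 * eps * (N x1 x1 x2) ^ 2)) /\
        N x1 x1 x2 <> 0 /\
        (eps = -1 -> N x1 x1 x2 <> 1 / sqrt 2 /\ N x1 x1 x2 <> - (1 / sqrt 2))))).
Proof.
  assert (rho_neq : ~ rho0_zero M).
  { intros Z; apply rho_neq0; intros i j p Hp.
    unfold nabla; rewrite ricci_sym_typeB, Z by assumption; ring. }
  assert (pow2_neq : forall t, t <> 0 -> t ^ 2 <> 0)
    by (intros; now apply pow_nonzero).
  (* One normal form serves both necessity directions, since dimension two implies dimension at
     least one. *)
  assert (nf : dim_ge (E mu M) 1 -> _) by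
    (intros H; destruct (dim_ge_nonzero mu M H) as (w & Ww & w0);
     exact (normal_form_exists M mu w notA rho_neq mu_neq0 mu_neqN1 Ww w0)).
  split; split.
  - intros H; destruct (nf H)
      as (N & eps & A & B & Heps & B0 & MN & c & e & g & t0 & _ & Hmu).
    exists N, eps; repeat split; auto.
    + apply linearly_equivalent_shear; now exists A, B.
    + rewrite <- Hmu; field; auto.
  - intros (N & eps & Heps & L & c & e & g & t0 & Hmu).
    apply linearly_equivalent_shear in L; destruct L as (A & B & B0 & MN).
    set (al := - mu * (N x1 x1 x1 - N x1 x2 x2 - 1)).
    exists (fun _ => eval (power al)); split.
    + intros _ _; apply E_power, (power_solution_shear M N mu al A B B0 MN).
      apply normal_power_solution with eps; auto.
      rewrite Hmu; field; auto.
    + intros k Hk i Hi; assert (Hc := Hk (1, 0) Rlt_0_1); simpl in Hc.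
      rewrite ln_1, Rmult_0_r, exp_0 in Hc.
      destruct i; [lra | lia].
  - intros H; destruct (nf (has_dim_dim_ge _ 2 1 (le_S _ _ (le_n _)) H))
      as (N & eps & A & B & Heps & B0 & MN & c & e & g & t0 & P & _).
    exists N, eps; split; [assumption|]; split.
    + apply linearly_equivalent_shear; now exists A, B.
    + apply two_solutions_cases; auto.
      apply (two_solutions_of_dim M N mu eps A B); auto; [lra|].
      destruct H as (f & Hf & ind & _); now exists f.
  - intros (N & eps & Heps & L & H).
    apply two_solutions_cases in H; auto.
    apply linearly_equivalent_shear in L; destruct L as (A & B & B0 & MN).
    apply (has_dim_two_solutions M N mu eps A B); auto; lra.
Qed.
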